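(* Let $\Omega\subset S^{n-1}$ be a closed set not contained in any closed hemisphere of $S^{n-1}$. Let $h_0:\Omega\rightarrow(0,\infty)$ and $f:\Omega\rightarrow\mathbb{R}$ be continuous, and let $[h_t]$ be a logarithmic family of Wulff shapes generated by $(h_0,f)$. Then for every $Q\in\mathcal{S}_o^n$, $j\neq n$, $q\neq0$, $$\lim_{t\rightarrow0}\frac{\widetilde{W}_{q,j}([h_t],Q)-\widetilde{W}_{q,j}([h_0],Q)}{t}=q\int_{\Omega}f(v)\,d\widetilde{\mathcal{C}}_{q,j}([h_0],Q,v).$$
   Context: $\mathcal{K}_o^n$: convex bodies in $\mathbb{R}^n$ containing the origin in their interiors; $\mathcal{S}_o^n$: compact sets star-shaped about the origin with positive continuous radial function $\rho_Q(x)=\max\{\lambda\ge0:\lambda x\in Q\}$. $h_M$ is the support function, $du$ spherical Lebesgue measure. A logarithmic family of Wulff shapes generated by $(h_0,f)$: for some $\delta>0$ and each $t\in(-\delta,\delta)$, $h_t:\Omega\to(0,\infty)$ is continuous with $\log h_t(v)=\log h_0(v)+tf(v)+o(t,v)$, where $o(t,\cdot)$ is continuous on $\Omega$ and $o(t,\cdot)/t\to0$ uniformly on $\Omega$ as $t\to0$; and $[h_t]=\{x\in\mathbb{R}^n:x\cdot v\le h_t(v)\ \forall v\in\Omega\}$. For $q\in\mathbb{R}$, $j\ne n$, $M\in\mathcal{K}_o^n$, $Q\in\mathcal{S}_o^n$: $\widetilde{W}_{q,j}(M,Q)=\frac1n\int_{S^{n-1}}\rho_M^q\rho_Q^{n-q-j}\,du$;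 $R^*_M(\eta)=\{u\in S^{n-1}:\rho_M(u)u\cdot v=h_M(v)\text{ for some }v\in\eta\}$ for Borel $\eta\subseteq S^{n-1}$; and $\widetilde{\mathcal{C}}_{q,j}(M,Q,\eta)=\frac1n\int_{R^*_M(\eta)}\rho_M^q(u)\rho_Q^{n-q-j}(u)\,du$. *)

(* Defs.v *)
From HB Require Import structures.
From mathcomp Require Import all_boot all_order all_algebra.
From mathcomp Require Import all_classical all_reals all_analysis.
Set Implicit Arguments. Unset Strict Implicit. Unset Printing Implicit Defensive.
Import Order.TTheory GRing.Theory Num.Theory numFieldNormedType.Exports.
Local Open Scope classical_set_scope.
Local Open Scope ring_scope.

Section Geometry.
Variables (R : realType) (n : nat).
Local Notation V := 'rV[R]_n.

Definition dot (x y : V) : R := \sum_(i < n) x 0 i * y 0 i.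
Definition enorm (x : V) : R := Num.sqrt (dot x x).

Definition sphere : set V := [set u | enorm u = 1].

Definition supportf (K : set V) (v : V) : R := sup ((fun x => dot x v) @` K).

(* radial function rho_K(x) = max{ l >= 0 : l x in K } (sup; = max for compact K) *)
Definition radial (K : set V) (x : V) : R := sup [set l : R | 0 <= l /\ K (l *: x)].

Definition wulff (Omega : set V) (h : V -> R) : set V :=
  [set x | forall v, Omega v -> dot x v <= h v].

(* Lebesgue integral on R^n of a function with values in \bar R, as the iterated
   one-dimensional Lebesgue integral (equal to the n-dimensional Lebesgue integral
   for the non-negative measurable integrands used below, by Tonelli). *)
Fixpoint iint (k : nat) (g : (nat -> R) -> \bar R) (x : nat -> R) : \bar R :=
  match k with
  | 0 => g x
  | k'.+1 => (\int[@lebesgue_measure R]_t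
                iint k' g (fun i => if i == k' then t else x i))%E
  end.

Definition lebint (G : V -> \bar R) : \bar R :=
  iint n (fun x => G (\row_(i < n) x (nat_of_ord i))) (fun _ => 0).

(* integral over S^{n-1} w.r.t. spherical Lebesgue measure du, via the cone
   formula  int_{S^{n-1}} g du = n * int_{0 < |x| <= 1} g(x/|x|) dx  *)
Definition sphint (g : V -> \bar R) : \bar R :=
  (n%:R%:E * lebint (fun x => if ((0 < enorm x) && (enorm x <= 1))%R
                             then g ((enorm x)^-1 *: x) else 0%E))%E.

Definition Wtilde (q j : R) (M Q : set V) : R :=
  n%:R^-1 * fine (sphint (fun u =>
     ((radial M u) `^ q * (radial Q u) `^ (n%:R - q - j))%:E)).

Definition Rstar (M : set V) (eta : set V) : set V :=
  [set u | sphere u /\ exists2 v, eta v & radial M u * dot u v = supportf M v].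

Definition Ctilde (q j : R) (M Q : set V) (eta : set V) : \bar R :=
  (n%:R^-1%:E * sphint (fun u =>
     (\1_(Rstar M eta) u * (radial M u) `^ q * (radial Q u) `^ (n%:R - q - j))%:E))%E.

Definition borelRn := g_sigma_algebraType (@open V).

End Geometry.

(* Main.v *)
(* Let p_t be the gauge of [h_t], so that p_t(x) is the maximum of <x, v> / h_t(v)
   over v in Omega and rho = 1 / p_t.  Evaluating each of p_0, p_t at a maximiser of
   the other one squeezes log rho_t(u) - log rho_0(u) between t f(v) + o(t, v) taken at
   a maximiser for p_t and at a maximiser for p_0.  When the maximiser v_0 for p_0 at u
   is unique, compactness forces those for p_t to converge to it, so log rho_t(u) has
   derivative f(v_0) at t = 0; dominated convergence then differentiates the integral
   of rho_t^q.  Two different outer normals at u give two different subgradients of the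
   convex function p_0, hence a kink of p_0 in some coordinate direction; a line
   contains at most one kink separated by two given rational slopes, so by Tonelli
   almost every direction has a single normal, which is v_0.  Thus the dual curvature
   measure is the image under u |-> v_0(u) of the measure with density
   rho_0^q rho_Q^(n-q-j). *)

Require Import Defs.
From HB Require Import structures.
From mathcomp Require Import all_boot all_order all_algebra.
From mathcomp Require Import all_classical all_reals all_analysis.
From mathcomp Require Import measurable_realfun lra ring.
Import Order.TTheory GRing.Theory Num.Theory numFieldNormedType.Exports.
Local Open Scope classical_set_scope.
Local Open Scope ring_scope.

Set Implicit Arguments.
Unset Strict Implicit.

(** * Borel sets and Lebesgue measure on R^n *)

(** The definitions supply no measure: [sphint] is an iterated one-dimensional integral over the
    ball, applicable to any function. It is identified with integration against a measure on
    nonnegative Borel functions, so every density must be shown Borel, and all the analysis takes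
    place on the punctured ball with [normalize x] in place of [u]. The dual curvature measure
    involves the indicator of a reverse radial Gauss image that may fail to be Borel; for it only
    monotonicity of the iterated integral is available. Exceptional directions are never measured on
    the sphere: the gauge is positively homogeneous, so [x] and [normalize x] have the same normals,
    and the exceptional set is a subset of R^n, met by coordinate lines. The gauge also keeps its
    meaning when [Omega] shrinks to a closed part of itself; comparing the two gauges yields both
    the measurability of the normal and the convergence of the maximisers. *)

Lemma continuous_borelRn_measurable (R : realType) (n : nat) (D : set 'rV[R]_n)
  (g : 'rV[R]_n -> R) :
  closed D -> {within D, continuous g} ->
  measurable_fun (T := borelRn R n) D g.
Proof.
move=> cD /continuousP cg; apply: (measurability _ (RGenOpens.measurableE R)).
move=> _ [_ [a [b ->] <-]].
have /open_subspaceP [V oV VD] : open (from_subspace D g @^-1` `]a, b[).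
  by apply: cg; exact: interval_open.
rewrite setIC -[X in measurable X]VD; apply: measurableI.
  by apply: sub_sigma_algebra.
rewrite -[X in measurable X]setCK; apply: measurableC; apply: sub_sigma_algebra.
exact: closed_openC.
Qed.

Lemma closed_borelRn_measurable (R : realType) (n : nat) (D : set (borelRn R n)) :
  closed (D : set 'rV[R]_n) -> measurable D.
Proof.
move=> cD; rewrite -[X in measurable X]setCK; apply: measurableC; apply: sub_sigma_algebra.
exact: closed_openC.
Qed.

Lemma measurable_coord (R : realType) (n : nat) (i : 'I_n) :
  measurable_fun setT (fun x : borelRn R n => x 0 i : R).
Proof.
apply: continuous_borelRn_measurable => //.
by apply/continuous_subspaceT => x; exact: coord_continuous.
Qed.

Lemma ball_rVE (R : realType) (n : nat) (x y : 'rV[R]_n) (e : R) : 0 < e ->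
  ball x e y <-> forall i, `|x 0 i - y 0 i| < e.
Proof.
move=> e0; split => [[_ +] i|xy]; first by move/(_ 0 i).
by split => // i j; rewrite (ord1 i); exact: xy.
Qed.

(** Balls of the norm on row vectors are boxes, and an open set is the countable union of the boxes
    inside it with rational centre and radius [k.+1%:R^-1]; the preimage of a box involves one
    coordinate at a time. *)
Lemma measurable_to_borelRn d (T : measurableType d) (R : realType) (n : nat)
  (F : T -> borelRn R n) :
  (forall i, measurable_fun setT (fun t => F t 0 i : R)) -> measurable_fun setT F.
Proof.
move=> mF; apply: (@measurability _ _ T (borelRn R n) setT F (@open 'rV[R]_n) erefl) => _ [U oU <-].
rewrite setTI.
pose box (p : {ffun 'I_n -> rat} * nat) : set 'rV[R]_n :=
  [set y | forall i, `|ratr (p.1 i) - y 0 i| < p.2.+1%:R^-1].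
rewrite (_ : F @^-1` U = \bigcup_p (if pselect (box p `<=` U) then F @^-1` (box p) else set0)).
  apply: countable_bigcupT_measurable => [|p]; first exact: countableP.
  case: pselect => /= _; last exact: measurable0.
  rewrite (_ : _ @^-1` _ = \bigcap_(i in [set: 'I_n])
    ((fun t => F t 0 i : R) @^-1` ball (ratr (p.1 i) : R) p.2.+1%:R^-1)).
    apply: fin_bigcap_measurable => // i _.
    rewrite -[X in measurable X]setTI; apply: mF => //.
    by apply: open_measurable; exact: ball_open.
  by apply/seteqP; split => t /= => [bt i _|bt i]; exact: bt.
apply/seteqP; split => t /=; last first.
  by move=> [p _]; case: pselect => /= [pU|_] // bt; exact: pU.
move=> Ut; have /nbhs_ballP [e e0 eU] := open_nbhs_nbhs (conj oU Ut).
(* A box of radius below [e / 2] that contains [F t] lies in the ball of radius [e] around it. *)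
have e20 : 0 < e / 2 by rewrite divr_gt0.
have [k ke] : exists k : nat, k.+1%:R^-1 < e / 2.
  by have [k _ /(_ k) ke] := near_infty_natSinv_lt (PosNum e20); exists k; exact: ke (leqnn _).
have k0 : 0 < k.+1%:R^-1 :> R by rewrite invr_gt0.
have rc i : exists r : rat, `|ratr r - F t 0 i| < k.+1%:R^-1.
  have /rat_in_itvoo [r] : F t 0 i - k.+1%:R^-1 < F t 0 i + k.+1%:R^-1
    by rewrite ltrBlDr -addrA ltrDl addr_gt0.
  by rewrite in_itv /= => rI; exists r; rewrite ltr_distl.
pose c := [ffun i => projT1 (cid (rc i))].
have cE i : `|ratr (c i) - F t 0 i| < k.+1%:R^-1 by rewrite ffunE; case: cid.
exists (c, k) => //; case: pselect => /= [_ i|]; first exact: cE.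
case=> y yb; apply: eU; apply/ball_rVE => // i.
have := cE i; have := yb i; rewrite /= => h1 h2.
rewrite (splitr e); apply: le_lt_trans (ltrD (lt_trans h2 ke) (lt_trans h1 ke)).
by rewrite (distrC (ratr (c i)) (F t 0 i)); exact: ler_distD.
Qed.

(* No measurability is needed: the integral of a nonnegative function is a
   supremum over the simple functions below it. *)
Lemma nonmeasurable_le_integral d (T : measurableType d)
  (R : realType) (mu : {measure set T -> \bar R}) (f g : T -> \bar R) :
  (forall x, 0 <= f x)%E -> (forall x, f x <= g x)%E ->
  (\int[mu]_x f x <= \int[mu]_x g x)%E.
Proof.
move=> f0 fg; rewrite !ge0_integralTE//; last by move=> x; apply: le_trans (fg x).
apply: le_ereal_sup => _ [h hf <-]; exists h => // x.
exact: le_trans (hf x) (fg x).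
Qed.

(** * Tonelli calculus for coordinatewise iterated integrals *)

Section IteratedIntegral.
Variables (R : realType) (n : nat).
Local Notation V := (borelRn R n).
Local Notation leb := (@lebesgue_measure R).
Implicit Types (G : V -> \bar R) (x : V).

Definition upd x (k : nat) (t : R) : V :=
  (\row_(i < n) (if i == k :> nat then t else (x : 'rV[R]_n) 0 i))%R.

Definition slice_int (k : nat) G x : \bar R := (\int[leb]_t G (upd x k t))%E.

Fixpoint iter_int (k : nat) G : V -> \bar R :=
  match k with
  | 0 => G
  | k'.+1 => slice_int k' (iter_int k' G)
  end.

(** [iint] runs over whole sequences, but the integrand reads only the first [n] terms. The
    induction needs an arbitrary starting sequence, not just the zero one. *)
Lemma lebint_iter (G : 'rV[R]_n -> \bar R) : lebint G = iter_int n G 0.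
Proof.
suff iE k (y : nat -> R) :
    iint k (fun z => G (\row_(i < n) z i)) y = iter_int k G (\row_(i < n) y i).
  by rewrite /lebint iE; congr (iter_int n G _); apply/rowP => i; rewrite !mxE.
elim: k y => [//|k IH] y /=; rewrite /slice_int; apply: eq_integral => t _.
by rewrite IH; congr (iter_int k G _); apply/rowP => i; rewrite !mxE.
Qed.

Lemma measurable_upd k : measurable_fun setT (fun xt : V * R => upd xt.1 k xt.2).
Proof.
apply: measurable_to_borelRn => i.
rewrite [X in measurable_fun _ X](_ : _ = if i == k :> nat then snd else
  (fun y : V => (y : 'rV[R]_n) 0 i) \o fst); last first.
  by apply/funext => -[y t] /=; rewrite mxE; case: eqP.
case: eqP => _; first exact: measurable_snd.
by apply: measurableT_comp; [exact: measurable_coord|exact: measurable_fst].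
Qed.

Lemma measurable_comp_upd k G : measurable_fun setT G ->
  measurable_fun setT (fun xt : V * R => G (upd xt.1 k xt.2)).
Proof. by move=> mG; apply: (measurableT_comp mG); exact: measurable_upd. Qed.

Lemma measurable_upd_r k G x : measurable_fun setT G ->
  measurable_fun setT (fun t : R => G (upd x k t)).
Proof.
move=> mG; exact: (measurableT_comp (measurable_comp_upd k mG) (pair1_measurable x)).
Qed.

Lemma updC x i j s t : i != j -> upd (upd x i s) j t = upd (upd x j t) i s.
Proof.
move=> ij; apply/rowP => a; rewrite !mxE.
by case: (eqVneq (a : nat) j) => [->|//]; rewrite eq_sym (negPf ij).
Qed.

Lemma measurable_slice_int k G : measurable_fun setT G -> (forall x, 0 <= G x)%E ->
  measurable_fun setT (slice_int k G).
Proof.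
move=> mG G0.
exact: (measurable_fun_fubini_tonelli_F (m2 := leb) _ (measurable_comp_upd k mG) (fun=> G0 _)).
Qed.

Lemma slice_int_ge0 k G : (forall x, 0 <= G x)%E -> forall x, (0 <= slice_int k G x)%E.
Proof. by move=> G0 x; apply: integral_ge0. Qed.

Lemma slice_intC i j G : i != j -> measurable_fun setT G -> (forall x, 0 <= G x)%E ->
  slice_int i (slice_int j G) = slice_int j (slice_int i G).
Proof.
move=> ij mG G0; apply/funext => x; rewrite /slice_int.
have m1 : measurable_fun setT (fun st : R * R => (upd x i st.1, st.2) : V * R).
  apply/measurable_fun_pairP; split; last exact: measurable_snd.
  exact: (measurableT_comp (measurable_upd i)
           (measurableT_comp (pair1_measurable x) measurable_fst)).
pose F (st : R * R) := G (upd (upd x i st.1) j st.2).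
have mF : measurable_fun setT F by exact: (measurableT_comp (measurable_comp_upd j mG) m1).
transitivity (\int[leb]_t \int[leb]_s F (s, t))%E.
  exact: (fubini_tonelli (m1 := leb) (m2 := leb) F mF (fun=> G0 _)).
by apply: eq_integral => t _; apply: eq_integral => s _; rewrite /F /= updC.
Qed.

Lemma iter_int_ge0 k G : (forall x, 0 <= G x)%E -> forall x, (0 <= iter_int k G x)%E.
Proof. by move=> G0; elim: k => [//|k IH] /=; exact: slice_int_ge0. Qed.

Lemma le_iter_int k G G' x : (forall x, 0 <= G x)%E -> (forall x, G x <= G' x)%E ->
  (iter_int k G x <= iter_int k G' x)%E.
Proof.
move=> G0 GG'; elim: k x => [//|k IH] x /=.
by apply: nonmeasurable_le_integral => t; [exact: iter_int_ge0|exact: IH].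
Qed.

Lemma measurable_iter_int k G : measurable_fun setT G -> (forall x, 0 <= G x)%E ->
  measurable_fun setT (iter_int k G).
Proof.
move=> mG G0; elim: k => [//|k IH] /=; apply: measurable_slice_int => //.
exact: iter_int_ge0.
Qed.

Lemma iter_intD k G G' x : measurable_fun setT G -> (forall x, 0 <= G x)%E ->
  measurable_fun setT G' -> (forall x, 0 <= G' x)%E ->
  iter_int k (G \+ G')%E x = (iter_int k G x + iter_int k G' x)%E.
Proof.
move=> mG G0 mG' G0'; elim: k x => [//|k IH] x /=; rewrite /slice_int.
rewrite -ge0_integralD//; first by apply: eq_integral => t _; exact: IH.
- by move=> t _; exact: iter_int_ge0.
- by apply: measurable_upd_r; exact: measurable_iter_int.
- by move=> t _; exact: iter_int_ge0.
- by apply: measurable_upd_r; exact: measurable_iter_int.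
Qed.

Lemma iter_intZ k G (c : R) x : measurable_fun setT G -> (forall x, 0 <= G x)%E -> 0 <= c ->
  iter_int k (fun y => c%:E * G y)%E x = (c%:E * iter_int k G x)%E.
Proof.
move=> mG G0 c0; elim: k x => [//|k IH] x /=; rewrite /slice_int.
rewrite -ge0_integralZl//; first by apply: eq_integral => t _; exact: IH.
- by apply: measurable_upd_r; exact: measurable_iter_int.
- by move=> t _; exact: iter_int_ge0.
Qed.

Lemma iter_int_lim k (G : nat -> V -> \bar R) x :
  (forall m, measurable_fun setT (G m)) -> (forall m x, 0 <= G m x)%E ->
  (forall x, {homo G ^~ x : a b / (a <= b)%N >-> (a <= b)%E}) ->
  iter_int k (fun y => limn (G ^~ y)) x = limn (fun m => iter_int k (G m) x).
Proof.
move=> mG G0 ndG; elim: k x => [//|k IH] x /=; rewrite /slice_int.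
rewrite -monotone_convergence//.
- by apply: eq_integral => t _; exact: IH.
- by move=> m; apply: measurable_upd_r; exact: measurable_iter_int.
- by move=> m t _; exact: iter_int_ge0.
- by move=> t _ a b ab; apply: le_iter_int => // y; exact: ndG.
Qed.

(** The vanishing integral in coordinate [i] commutes with those in the coordinates below [i], so
    the iterated integral is already zero once coordinate [i] is integrated, and further
    integrations keep it zero. *)
Lemma iter_int_slice0 k i G : measurable_fun setT G -> (forall x, 0 <= G x)%E ->
  (forall x, slice_int i G x = 0%E) -> (i < k)%N -> forall x, iter_int k G x = 0%E.
Proof.
move=> mG G0 Gi.
have H0 j x : (j <= i)%N -> slice_int i (iter_int j G) x = 0%E.
  elim: j x => [|j IH] x ji /=; first exact: Gi.
  rewrite slice_intC ?gtn_eqF//; last 2 first.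
  - exact: measurable_iter_int.
  - exact: iter_int_ge0.
  by rewrite /slice_int integral0_eq// => t _; rewrite [LHS]IH// ltnW.
elim: k => [//|k IH]; rewrite ltnS leq_eqVlt => /predU1P[<-|ik] x /=; first exact: H0.
by rewrite /slice_int integral0_eq// => t _; exact: IH.
Qed.

End IteratedIntegral.

Import HBNNSimple.

(** Approximation by simple functions from below, stated for an abstract functional because it
    serves twice: for [lebint] against [lebRn], and for the image of a weighted measure. *)
Lemma ge0_functional_integral d (T : measurableType d) (R : realType)
  (mu : {measure set T -> \bar R}) (L : (T -> \bar R) -> \bar R) :
  (forall f g, measurable_fun setT f -> (forall x, 0 <= f x)%E ->
     measurable_fun setT g -> (forall x, 0 <= g x)%E ->
     L (fun x => f x + g x)%E = (L f + L g)%E) ->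
  (forall (c : R) f, 0 <= c -> measurable_fun setT f -> (forall x, 0 <= f x)%E ->
     L (fun x => c%:E * f x)%E = (c%:E * L f)%E) ->
  (forall f : nat -> T -> \bar R, (forall m, measurable_fun setT (f m)) ->
     (forall m x, 0 <= f m x)%E ->
     (forall x, {homo f ^~ x : a b / (a <= b)%N >-> (a <= b)%E}) ->
     L (fun x => limn (f ^~ x)) = limn (fun m => L (f m))) ->
  (forall A, measurable A -> L (fun x => (\1_A x)%:E) = mu A) ->
  forall f, measurable_fun setT f -> (forall x, 0 <= f x)%E -> L f = (\int[mu]_x f x)%E.
Proof.
move=> LD LZ Llim L1 f mf f0.
pose g := nnsfun_approx measurableT mf.
have gnd x : {homo (fun m => (g m x)%:E) : a b / (a <= b)%N >-> (a <= b)%E}.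
  by move=> a b ab; rewrite lee_fin; apply/lefP: x; exact: nd_nnsfun_approx.
have fE : f = fun x => limn (fun m => (g m x)%:E).
  by apply/funext => x; apply/esym/cvg_lim => //; exact: cvg_nnsfun_approx.
have mg m : measurable_fun setT (fun x => (g m x)%:E) by exact/measurable_EFinP.
have g0 m x : (0 <= (g m x)%:E)%E by rewrite lee_fin.
rewrite fE monotone_convergence// Llim//; congr (limn _); apply/funext => m.
have L0 : L (fun=> 0)%E = 0%E.
  transitivity (mu set0); last exact: measure0.
  by rewrite -L1//; congr L; apply/funext => x; rewrite indic0.
rewrite integralT_nnsfun sintegralE.
transitivity (L (fun x => \sum_(r \in range (g m)) (r * \1_(g m @^-1` [set r]) x)%:E)%E).
  by congr L; apply/funext => x; rewrite fimfunE -fsumEFin.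
rewrite !fsbig_finite//=; under eq_fun do rewrite fsbig_finite//=.
have : all (fun r : R => 0 <= r) (finmap.enum_fset (fset_set (range (g m)))).
  by apply/allP => r; rewrite in_fset_set// inE => -[x _ <-].
elim: (finmap.enum_fset _) => [|r s IH] /=.
  by rewrite big_nil -L0 => _; congr L; apply/funext => x; rewrite big_nil.
move=> /andP[r0 s0]; rewrite big_cons -IH// -L1 -?LZ//.
- rewrite -LD//; first by congr L; apply/funext => x; rewrite big_cons EFinM.
  + by apply: measurable_funeM; exact/measurable_EFinP.
  + by move=> x; rewrite mule_ge0// lee_fin.
  + by apply: emeasurable_sum => i; apply/measurable_EFinP; exact: measurable_funM.
  + move=> x; rewrite big_seq; apply: sume_ge0 => i /(allP s0) i0.
    by rewrite lee_fin mulr_ge0.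
- exact/measurable_EFinP.
Qed.

(** * Lebesgue measure on R^n *)

Section LebesgueRn.
Variables (R : realType) (n : nat).
Local Notation V := (borelRn R n).

(** Built from the iterated integral itself, so that [lebint] is linked to a measure by its values
    on indicators; null sets and dominated convergence then become available. *)
Definition lebRn (A : set V) : \bar R := lebint (fun x : 'rV[R]_n => (\1_A x)%:E).

Let mindic (A : set V) : measurable A -> measurable_fun setT (fun x : V => (\1_A x)%:E : \bar R).
Proof. by move=> mA; apply/measurable_EFinP; exact: measurable_indic. Qed.

Let lebRn0 : lebRn set0 = 0%E.
Proof.
rewrite /lebRn lebint_iter; set G := (fun x => _); have -> : G = fun=> 0%E by apply/funext => y; rewrite /G indic0.
suff H k (x : V) : iter_int k (fun=> 0%E) x = 0%E :> \bar R by exact: H.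
by elim: k x => [//|k IH] x /=; rewrite /slice_int integral0_eq// => t _; rewrite IH.
Qed.

Let lebRn_ge0 A : (0 <= lebRn A)%E.
Proof. by rewrite /lebRn lebint_iter; apply: iter_int_ge0 => x; rewrite lee_fin. Qed.

Let lebRn_sigma_additive : semi_sigma_additive lebRn.
Proof.
move=> F mF tF mUF.
have mS m : measurable_fun setT (fun x : V => \sum_(0 <= i < m) (\1_(F i) x)%:E : \bar R).
  by apply: emeasurable_sum => i; exact: mindic.
have S0 m (x : V) : (0 <= \sum_(0 <= i < m) (\1_(F i) x)%:E :> \bar R)%E.
  by apply: sume_ge0 => i _; rewrite lee_fin.
have Snd (x : V) : {homo (fun m => \sum_(0 <= i < m) (\1_(F i) x)%:E : \bar R) :
    a b / (a <= b)%N >-> (a <= b)%E}.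
  by apply: ereal_nondecreasing_series => i _ _; rewrite lee_fin.
have SE m : (\sum_(0 <= i < m) lebRn (F i))%E =
    iter_int n (fun x : V => \sum_(0 <= i < m) (\1_(F i) x)%:E)%E 0.
  elim: m => [|m IH].
    rewrite big_nil -[LHS]lebRn0 /lebRn lebint_iter; congr iter_int.
    by apply/funext => x; rewrite big_nil indic0.
  rewrite big_nat_recr//= IH /lebRn lebint_iter -iter_intD//.
  - by congr iter_int; apply/funext => x; rewrite big_nat_recr.
  exact: mindic.
rewrite [lebRn (\bigcup__ _)](_ : _ =
    limn (fun m => \sum_(0 <= i < m) lebRn (F i))%E).
  apply: ereal_nondecreasing_is_cvgn.
  by apply: ereal_nondecreasing_series => i _ _.
rewrite (funext SE) -iter_int_lim// /lebRn lebint_iter; congr iter_int.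
by apply/funext => x; rewrite indic_bigcup.
Qed.

HB.instance Definition _ := isMeasure.Build _ V R lebRn lebRn0 lebRn_ge0 lebRn_sigma_additive.

Lemma lebint_integral (G : V -> \bar R) : measurable_fun setT G -> (forall x, 0 <= G x)%E ->
  lebint (G : 'rV[R]_n -> \bar R) = (\int[lebRn]_x G x)%E.
Proof.
apply: ge0_functional_integral.
- by move=> f g mf f0 mg g0; rewrite !lebint_iter; exact: iter_intD.
- by move=> c f c0 mf f0; rewrite !lebint_iter; exact: iter_intZ.
- move=> f mf f0 ndf; rewrite lebint_iter iter_int_lim//.
  by congr (limn _); apply/funext => m; rewrite lebint_iter.
- by move=> A mA.
Qed.

Lemma lebRn_slice0 (i : 'I_n) (N : set V) : measurable N ->
  (forall x : V, lebesgue_measure [set t | N (upd x i t)] = 0%E) -> lebRn N = 0%E.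
Proof.
move=> mN N0; rewrite /lebRn lebint_iter.
apply: (@iter_int_slice0 _ _ _ i) => //; first exact: mindic.
move=> x.
have mNx : measurable [set t : R | N (upd x i t)].
  have mu := measurableT_comp (measurable_upd i) (pair1_measurable x).
  by rewrite -[X in measurable X]setTI; exact: (mu measurableT N mN).
transitivity (\int[lebesgue_measure]_t (\1_[set t : R | N (upd x i t)] t)%:E)%E => //.
by rewrite integral_indic// setIT; exact: N0.
Qed.

Lemma lebRn_cube_lty : (lebRn [set x | forall i, (`|(x : 'rV[R]_n) 0 i| <= 1)%R] < +oo)%E.
Proof.
rewrite /lebRn lebint_iter; set G := (fun x => _).
(* Each integration contributes the length 2 of [[-1, 1]] and releases its coordinate from the
   constraint. *)
suff H k (x : V) : (k <= n)%N -> (iter_int k G x <=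
    (2 ^+ k * \1_[set y : V | forall i : 'I_n, (k <= i)%N -> (`|(y : 'rV[R]_n) 0 i| <= 1)%R] x)%:E)%E.
  by apply: le_lt_trans (H _ _ (leqnn n)) _; rewrite ltry.
elim: k x => [|k IH] x kn /=.
  rewrite expr0 mul1r /G lee_fin !indicE ler_nat.
  have [|//] := boolP (x \in _); rewrite inE => Gx.
  by rewrite mem_set// => i _; exact: Gx.
pose C : R := 2 ^+ k *
  \1_[set y : V | forall i : 'I_n, (k.+1 <= i)%N -> (`|(y : 'rV[R]_n) 0 i| <= 1)%R] x.
have C0 : 0 <= C by rewrite mulr_ge0// exprn_ge0.
have mI : measurable (`[-1, 1]%classic : set R) by exact: measurable_itv.
apply: (@le_trans _ _ (\int[lebesgue_measure]_t (C%:E * (\1_(`[-1, 1]%classic : set R) t)%:E))%E).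
  apply: nonmeasurable_le_integral => t.
    by apply: iter_int_ge0 => y; rewrite lee_fin.
  apply: le_trans (IH _ (ltnW kn)) _; rewrite -EFinM lee_fin /C -mulrA ler_wpM2l ?exprn_ge0//.
  rewrite !indicE -natrM ler_nat.
  have [|//] := boolP (upd _ _ _ \in _); rewrite inE /= => ux.
  rewrite !mem_set//=.
    have := ux (Ordinal kn) (leqnn _); rewrite mxE eqxx.
    by rewrite in_itv /= ler_norml.
  by move=> i ki; have := ux i (ltnW ki); rewrite mxE gtn_eqF.
rewrite ge0_integralZl//; last by apply/measurable_EFinP; exact: measurable_indic.
have lI : lebesgue_measure (`[-1, 1]%classic : set R) = 2%:E.
  by rewrite lebesgue_measure_itv/= lte_fin ifT ?EFinN -?EFinB ?opprK//; lra.
rewrite [X in (_ * X)%E](_ : _ = 2%:E); last by rewrite integral_indic// setIT; exact: lI.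
by rewrite -EFinM lee_fin /C exprSr mulrAC.
Qed.

End LebesgueRn.

(** * Gauges of Wulff shapes *)

Lemma continuous_sumr (R : realType) (T : topologicalType) (I : Type) (r : seq I)
  (f : I -> T -> R) : (forall i, continuous (f i)) ->
  continuous (fun x => \sum_(i <- r) f i x).
Proof.
move=> fc x; elim: r => [|i r IH].
  by under eq_fun do rewrite big_nil; exact: cvg_cst.
by under eq_fun do rewrite big_cons; apply: cvgD => //; exact: fc.
Qed.

Section DotProduct.
Variables (R : realType) (n : nat).
Implicit Types (x y v w : 'rV[R]_n) (c : R).

Lemma dotDl x y v : dot (x + y) v = dot x v + dot y v.
Proof. by rewrite /dot -big_split; apply: eq_bigr => i _; rewrite !mxE mulrDl. Qed.

Lemma dotZl c x v : dot (c *: x) v = c * dot x v.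
Proof. by rewrite /dot mulr_sumr; apply: eq_bigr => i _; rewrite !mxE mulrA. Qed.

Lemma dotC x v : dot x v = dot v x.
Proof. by apply: eq_bigr => i _; rewrite mulrC. Qed.

Lemma dotZr c x v : dot x (c *: v) = c * dot x v.
Proof. by rewrite dotC dotZl dotC. Qed.

Lemma dot_delta (i : 'I_n) v : dot (delta_mx 0 i) v = v 0 i.
Proof.
rewrite /dot (bigD1 i)//= mxE !eqxx mul1r big1 ?addr0// => j ji.
by rewrite mxE (negPf ji) andbF mul0r.
Qed.

Lemma dot_ge0 x : 0 <= dot x x.
Proof. by apply: sumr_ge0 => i _; rewrite -expr2 sqr_ge0. Qed.

Lemma enorm_ge0 x : 0 <= enorm x.
Proof. exact: sqrtr_ge0. Qed.

Lemma enorm_sqr x : enorm x ^+ 2 = dot x x.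
Proof. by rewrite sqr_sqrtr// dot_ge0. Qed.

Lemma enormZ c x : enorm (c *: x) = `|c| * enorm x.
Proof.
by rewrite /enorm dotZl dotZr mulrA -expr2 sqrtrM ?sqr_ge0// sqrtr_sqr.
Qed.

Lemma coord_le_enorm x (i : 'I_n) : `|x 0 i| <= enorm x.
Proof.
rewrite -ler_sqr ?nnegrE ?enorm_ge0// enorm_sqr real_normK ?num_real//.
rewrite /dot (bigD1 i)//= expr2 lerDl.
by apply: sumr_ge0 => j _; rewrite -expr2 sqr_ge0.
Qed.

Lemma enorm_eq0 x : enorm x = 0 -> x = 0.
Proof.
move=> x0; apply/rowP => i; rewrite mxE; apply/eqP; rewrite -normr_eq0.
by rewrite eq_le normr_ge0 andbT -x0 coord_le_enorm.
Qed.

Definition normalize x : 'rV[R]_n := (enorm x)^-1 *: x.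

Lemma sphere_normalize x : 0 < enorm x -> sphere (normalize x).
Proof.
by move=> x0; rewrite /sphere /= enormZ ger0_norm ?invr_ge0 ?ltW// mulVf ?gt_eqF.
Qed.

Lemma dot_continuous v : continuous (fun x => dot x v).
Proof.
apply: continuous_sumr => i x.
by apply: continuousM; [exact: coord_continuous|exact: cst_continuous].
Qed.

Lemma dot_continuousr x : continuous (dot x).
Proof. by rewrite (funext (dotC x)); exact: dot_continuous. Qed.

Lemma enorm_continuous : continuous (@enorm R n).
Proof.
move=> x; apply: (@continuous_comp _ _ _ (fun x => dot x x) Num.sqrt); last exact: sqrt_continuous.
by apply: continuous_sumr => i y; apply: continuousM; exact: coord_continuous.
Qed.

Lemma compact_sphere : compact (@sphere R n).
Proof.
apply: bounded_closed_compact.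
  exists 1; split; first exact: num_real.
  move=> M M1 x /= sx; rewrite [leLHS]mx_normrE; apply: bigmax_le; first exact: le_trans (ltW M1).
  by move=> [i j] _ /=; rewrite ord1 (le_trans (coord_le_enorm _ _))// sx ltW.
rewrite (_ : @sphere R n = @enorm R n @^-1` [set 1])//.
by apply: closed_comp => [x _|]; [exact: enorm_continuous|exact: closed_eq].
Qed.

Lemma sphere_dot v : sphere v -> dot v v = 1.
Proof. by move=> sv; rewrite -enorm_sqr sv expr1n. Qed.

Lemma sphere_scale_inj v w (d e : R) : sphere v -> sphere w -> 0 < d -> 0 < e ->
  d *: v = e *: w -> v = w.
Proof.
move=> sv sw d0 e0 dvew.
have de : d = e.
  by have := congr1 (@enorm R n) dvew; rewrite !enormZ sv sw !mulr1 !gtr0_norm.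
move: dvew; rewrite -de => /(congr1 (fun z => d^-1 *: z)).
by rewrite !scalerA mulVf ?gt_eqF// !scale1r.
Qed.

End DotProduct.

Lemma compact_pos_bounds (R : realType) (T : topologicalType) (A : set T) (g : T -> R) :
  compact A -> {within A, continuous g} -> (forall x, A x -> 0 < g x) ->
  exists c C, [/\ 0 < c, 0 < C & forall x, A x -> c <= g x <= C].
Proof.
move=> cA cg g0; have [A0|/set0P A0] := eqVneq A set0.
  by exists 1, 1; split => // x; rewrite A0.
have [a /set_mem Aa ga] := compact_EVT_min A0 cA cg.
have [b /set_mem Ab gb] := compact_EVT_max A0 cA cg.
exists (g a), (g b); split; [exact: g0|exact: g0|move=> x /mem_set Ax].
by rewrite ga// gb.
Qed.

Section Gauge.
Variables (R : realType) (n : nat).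
Implicit Types (x y v w : 'rV[R]_n) (h : 'rV[R]_n -> R) (Omega : set 'rV[R]_n).

Definition gauge Omega h x : R := sup [set dot x v / h v | v in Omega].

(** Conditions under which the supremum in [gauge] is attained. They pass to every nonempty closed
    part of [Omega]; positivity of the gauge is kept apart, since such a part may lie in a closed
    hemisphere. *)
Definition gauge_dom Omega h := [/\ Omega !=set0, compact Omega, Omega `<=` @sphere R n,
  {within Omega, continuous h} & forall v, Omega v -> 0 < h v].

Section GaugeTheory.
Variables (Omega : set 'rV[R]_n) (h : 'rV[R]_n -> R).
Hypothesis Oh : gauge_dom Omega h.
Local Notation p := (gauge Omega h).

Let ratio_continuous x : {within Omega, continuous (fun v => dot x v / h v)}.
Proof.
have [_ _ _ ch h0] := Oh; rewrite continuous_subspace_in => v /set_mem Ov.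
apply: cvgM; last by apply: cvgV; [rewrite gt_eqF ?h0|exact: ch].
by apply: (@continuous_subspaceT _ _ Omega (dot x)) => w; exact: dot_continuousr.
Qed.

Lemma gauge_ub x v : Omega v -> dot x v / h v <= p x.
Proof.
move=> Ov; have [nO cO _ _ _] := Oh.
have [w _ wM] := compact_EVT_max nO cO (@ratio_continuous x).
apply: ub_le_sup; last by exists v.
by exists (dot x w / h w) => _ [z /mem_set Oz <-]; exact: wM.
Qed.

Lemma gauge_attained x : exists2 v, Omega v & p x = dot x v / h v.
Proof.
have [nO cO _ _ _] := Oh.
have [v /set_mem Ov vM] := compact_EVT_max nO cO (@ratio_continuous x).
exists v => //; apply/eqP; rewrite eq_le gauge_ub// andbT.
by apply: ge_sup; [exists (dot x v / h v), v|move=> _ [w /mem_set Ow <-]; exact: vM].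
Qed.

Lemma gaugeD x y : p (x + y) <= p x + p y.
Proof.
have [v Ov ->] := gauge_attained (x + y).
by rewrite dotDl mulrDl lerD ?gauge_ub.
Qed.

Lemma gaugeZ c x : 0 <= c -> p (c *: x) = c * p x.
Proof.
move=> c0; apply/eqP; rewrite eq_le; apply/andP; split.
  have [v Ov ->] := gauge_attained (c *: x).
  by rewrite dotZl -mulrA ler_wpM2l// gauge_ub.
have [v Ov ->] := gauge_attained x.
by rewrite mulrA -dotZl gauge_ub.
Qed.

(** By subadditivity it suffices to bound [p] by a multiple of the sum of the [|x 0 i|]; this holds
    because [h] is at least some [c > 0] and unit vectors have coordinates of modulus at most 1. *)
Lemma gauge_lipschitz : exists2 K, 0 <= K & forall x y,
  `|p x - p y| <= K * \sum_(i < n) `|x 0 i - y 0 i|.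
Proof.
have [nO cO sO ch h0] := Oh.
have [c [C [c0 C0 cC]]] := compact_pos_bounds cO ch h0.
have H x : p x <= c^-1 * \sum_(i < n) `|x 0 i|.
  have [v Ov ->] := gauge_attained x.
  rewrite mulrC; apply: le_trans (ler_norm _) _; rewrite normrM.
  apply: ler_pM => //; last first.
    apply: le_trans (ler_norm_sum _ _ _) _; apply: ler_sum => i _.
    by rewrite normrM ler_piMr// (le_trans (coord_le_enorm v i))// (sO _ Ov).
  rewrite normfV gtr0_norm ?h0// lef_pV2 ?posrE ?h0//.
  by have /andP[] := cC v Ov.
exists c^-1; first by rewrite invr_ge0 ltW.
have H2 x y : p x - p y <= c^-1 * \sum_(i < n) `|x 0 i - y 0 i|.
  rewrite lerBlDl; apply: (@le_trans _ _ (p (y + (x - y)))); first by rewrite addrC subrK.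
  apply: le_trans (gaugeD _ _) _; rewrite lerD2l; apply: le_trans (H _) _.
  by rewrite le_eqVlt; apply/orP; left; apply/eqP; congr (_ * _); apply: eq_bigr => i _; rewrite !mxE.
move=> x y; rewrite ler_norml H2 andbT lerNl opprB; apply: le_trans (H2 y x) _.
by rewrite le_eqVlt; apply/orP; left; apply/eqP; congr (_ * _); apply: eq_bigr => i _; rewrite distrC.
Qed.

Lemma gauge_continuous : continuous p.
Proof.
have [K K0 KL] := gauge_lipschitz => x.
have Sc : continuous (fun y : 'rV[R]_n => \sum_(i < n) `|x 0 i - y 0 i|).
  apply: continuous_sumr => i y.
  apply: (@continuous_comp _ _ _ (fun y : 'rV[R]_n => x 0 i - y 0 i) (fun t : R => `|t|)).
    by apply: continuousB; [exact: cst_continuous|exact: coord_continuous].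
  exact: norm_continuous.
have S0 : (fun y => K * \sum_(i < n) `|x 0 i - y 0 i|) @ x --> 0.
  rewrite [X in _ --> X](_ : _ = K * \sum_(i < n) `|x 0 i - x 0 i|); last first.
    by rewrite big1 ?mulr0// => i _; rewrite subrr normr0.
  have KSc : continuous (fun y : 'rV[R]_n => K * \sum_(i < n) `|x 0 i - y 0 i|).
    by move=> y; apply: continuousM; [exact: cst_continuous|exact: Sc].
  exact: KSc.
apply/(@cvgrPdist_lt _ _ _ _ (nbhs_filter x)) => e e0.
move/(@cvgrPdist_lt _ _ _ _ (nbhs_filter x)) : S0 => /(_ e e0).
apply: filterS => y; rewrite sub0r normrN; apply: le_lt_trans.
exact: le_trans (KL x y) (ler_norm _).
Qed.

Lemma wulff_gauge x : wulff Omega h x <-> p x <= 1.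
Proof.
have [_ _ _ _ h0] := Oh; split => [xW|px v Ov].
  have [v Ov ->] := gauge_attained x.
  by rewrite ler_pdivrMr ?h0// mul1r; exact: xW.
have := le_trans (gauge_ub x Ov) px.
by rewrite ler_pdivrMr ?h0// mul1r.
Qed.

Lemma radial_wulff x : 0 < p x -> radial (wulff Omega h) x = (p x)^-1.
Proof.
move=> px; have pV : 0 <= (p x)^-1 by rewrite invr_ge0 ltW.
have ub : ubound [set l | 0 <= l /\ wulff Omega h (l *: x)] (p x)^-1.
  move=> l [l0 /wulff_gauge]; rewrite gaugeZ// => lp.
  by rewrite -[leRHS]mul1r ler_pdivlMr.
have in_ : [set l | 0 <= l /\ wulff Omega h (l *: x)] (p x)^-1.
  by split => //; apply/wulff_gauge; rewrite gaugeZ// mulVf// gt_eqF.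
apply/eqP; rewrite eq_le; apply/andP; split.
  by apply: ge_sup => //; exists (p x)^-1.
by apply: ub_le_sup => //; exists (p x)^-1.
Qed.

End GaugeTheory.
End Gauge.

(** * Kinks of the gauge and the almost everywhere unique normal *)

Section GaugeNormal.
Variables (R : realType) (n : nat) (Omega : set 'rV[R]_n) (h : 'rV[R]_n -> R).
Hypothesis Oh : gauge_dom Omega h.
Local Notation p := (gauge Omega h).
Local Notation V := (borelRn R n).
Local Notation leb := (@lebRn R n).
Implicit Types (x y v w : 'rV[R]_n).

(* The slopes [a] and [b] both support [p] at [x] in direction [i]. *)
Definition gauge_kink (i : 'I_n) (a b : R) : set V :=
  [set x : 'rV[R]_n | forall s, p x + Num.max (a * s) (b * s) <= p (x + s *: delta_mx 0 i)].

Lemma measurable_gauge_kink i a b : measurable (gauge_kink i a b).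
Proof.
apply: closed_borelRn_measurable.
pose d (s : R) (x : 'rV[R]_n) : R := p (x + s *: delta_mx 0 i) - p x.
have pc := gauge_continuous Oh.
have dc s : continuous (d s).
  have tc : continuous (fun x : 'rV[R]_n => p (x + s *: delta_mx 0 i)).
    move=> x.
    apply: (@continuous_comp _ _ _ (fun x : 'rV[R]_n => x + s *: delta_mx 0 i) p); last exact: pc.
    by apply: continuousD; [exact: cvg_id|exact: cst_continuous].
  by move=> x; exact: (continuousB (tc x) (pc x)).
rewrite (_ : gauge_kink i a b =
    \bigcap_(s in [set: R]) (d s @^-1` [set r : R | Num.max (a * s) (b * s) <= r])); last first.
  apply/seteqP; split => x /= H s; first by move=> _; rewrite /= lerBrDl; exact: H.
  by have := H s I; rewrite /= lerBrDl.
apply: closed_bigI => s _; apply: preimage_closed => [x _|]; first exact: dc.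
exact: closed_ge.
Qed.

(** Adding the inequality at [x] with step [s] to the one at the other point with step [- s] cancels
    the gauges and leaves [(b - a) * |s| <= 0]. *)
Lemma gauge_kink_line i a b x s : a < b -> gauge_kink i a b x ->
  gauge_kink i a b (x + s *: delta_mx 0 i) -> s = 0.
Proof.
move=> ab /(_ s) h1 /(_ (- s)); rewrite scaleNr addrK => h2.
have m1 : b * s <= Num.max (a * s) (b * s) by rewrite le_max lexx orbT.
have m2 : a * s <= Num.max (a * s) (b * s) by rewrite le_max lexx.
have m3 : b * - s <= Num.max (a * - s) (b * - s) by rewrite le_max lexx orbT.
have m4 : a * - s <= Num.max (a * - s) (b * - s) by rewrite le_max lexx.
apply/eqP; rewrite eq_le; apply/andP; split.
  rewrite leNgt; apply/negP => s0.
  have : a * s < b * s by rewrite ltr_pM2r.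
  by move: h1 h2 m1 m4; rewrite mulrN; lra.
rewrite leNgt; apply/negP => s0.
have : b * s < a * s by rewrite ltr_nM2r.
by move: h1 h2 m2 m3; rewrite mulrN; lra.
Qed.

Lemma lebRn_gauge_kink i a b : a < b -> leb (gauge_kink i a b) = 0%E.
Proof.
move=> ab; apply: (@lebRn_slice0 _ _ i) => [|x]; first exact: measurable_gauge_kink.
have [->|/set0P[t0 Kt0]] := eqVneq [set t | gauge_kink i a b (upd x i t)] set0.
  by rewrite measure0.
rewrite (_ : [set _ | _] = [set t0]) ?lebesgue_measure_set1//.
apply/seteqP; split => [t /= Kt|_ ->//].
have E : upd x i t = (upd x i t0 : 'rV[R]_n) + (t - t0) *: delta_mx 0 i.
  apply/rowP => j; rewrite !mxE eqxx /=; have [->|ji] := eqVneq j i.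
    by rewrite eqxx mulr1 addrC subrK.
  by rewrite (_ : (j == i :> nat) = false) ?mulr0 ?addr0//; exact/negbTE.
rewrite E in Kt; have /eqP := gauge_kink_line ab Kt0 Kt.
by rewrite subr_eq0 => /eqP.
Qed.

(** Countability of the triples of a direction and two rational slopes, made explicit by [unpickle],
    is what keeps this union null. *)
Definition gauge_sing : set V := \bigcup_(k : nat)
  match unpickle k : option ('I_n * (rat * rat)) with
  | Some (i, (a, b)) => if a < b then gauge_kink i (ratr a) (ratr b) else set0
  | None => set0
  end.

Lemma measurable_gauge_sing : measurable gauge_sing.
Proof.
apply: bigcup_measurable => k _; case: unpickle => [[i [a b]]|//].
by case: ifP => // _; exact: measurable_gauge_kink.
Qed.

Lemma negligible_gauge_sing : leb.-negligible gauge_sing.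
Proof.
apply: negligible_bigcup => k; case: unpickle => [[i [a b]]|]; last exact: negligible_set0.
case: ifP => [ab|_]; last exact: negligible_set0.
exists (gauge_kink i (ratr a) (ratr b)); split => //; first exact: measurable_gauge_kink.
by apply: lebRn_gauge_kink; rewrite ltr_rat.
Qed.

Lemma subgradient_unique x w w' : ~ gauge_sing x ->
  (forall y, dot y w <= p y) -> (forall y, dot y w' <= p y) ->
  dot x w = p x -> dot x w' = p x -> w = w'.
Proof.
move=> xS; suff H u u' i : (forall y, dot y u <= p y) -> (forall y, dot y u' <= p y) ->
    dot x u = p x -> dot x u' = p x -> u' 0 i <= u 0 i.
  by move=> h1 h2 h3 h4; apply/rowP => i; apply/eqP; rewrite eq_le !H.
move=> h1 h2 h3 h4; rewrite leNgt; apply/negP => uu'; apply: xS.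
(* Rational slopes with [u 0 i < a < b < u' 0 i]. *)
have [a] := rat_in_itvoo uu'; rewrite in_itv /= => /andP[ua au'].
have [b] := rat_in_itvoo au'; rewrite in_itv /= => /andP[ab bu'].
exists (pickle (i, (a, b))) => //; rewrite pickleK.
have -> : a < b by rewrite -(ltr_rat R).
move=> s; have := h1 (x + s *: delta_mx 0 i); have := h2 (x + s *: delta_mx 0 i).
rewrite !dotDl !dotZl !dot_delta h3 h4 => H2 H1.
rewrite -lerBrDl ge_max !lerBrDl.
(* Forward steps use the larger slope [u' 0 i], backward steps the smaller slope [u 0 i]. *)
have [s0|s0] := leP 0 s; apply/andP; split.
- by apply: le_trans H2; rewrite lerD2l mulrC ler_wpM2l// ltW.
- by apply: le_trans H2; rewrite lerD2l mulrC ler_wpM2l// ltW.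
- by apply: le_trans H1; rewrite lerD2l mulrC ler_wnM2l// ltW.
- by apply: le_trans H1; rewrite lerD2l mulrC ler_wnM2l// ltW// (lt_trans ua ab).
Qed.

Definition gauge_normal x : 'rV[R]_n := s2val (cid2 (gauge_attained Oh x)).

Lemma gauge_normalP x : Omega (gauge_normal x).
Proof. exact: (s2valP (cid2 (gauge_attained Oh x))). Qed.

Lemma gauge_normalE x : p x = dot x (gauge_normal x) / h (gauge_normal x).
Proof. exact: (s2valP' (cid2 (gauge_attained Oh x))). Qed.

Lemma gauge_subgradient v : Omega v -> forall y, dot y ((h v)^-1 *: v) <= p y.
Proof. by move=> Ov y; rewrite dotZr mulrC; exact: gauge_ub. Qed.

(** Maximisers [v] correspond to subgradients [(h v)^-1 *: v]; equal subgradients put two unit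
    vectors on the same ray. *)
Lemma gauge_normal_unique x v : ~ gauge_sing x -> Omega v -> p x = dot x v / h v ->
  v = gauge_normal x.
Proof.
move=> xS Ov pv; have [_ _ sO _ h0] := Oh; have On := gauge_normalP x.
apply: (@sphere_scale_inj _ _ _ _ (h v)^-1 (h (gauge_normal x))^-1); rewrite ?invr_gt0 ?h0//.
- exact: sO.
- exact: sO.
apply: (subgradient_unique xS).
- exact: gauge_subgradient.
- exact: gauge_subgradient.
- by rewrite dotZr pv mulrC.
- by rewrite dotZr gauge_normalE mulrC.
Qed.

(** On the null set [gauge_sing] the chosen normal may depend on [x] in a non-measurable way, so a
    constant replaces it; [gauge_normal 0] merely names a point of [Omega]. *)
Definition gauss_map x : 'rV[R]_n :=
  if pselect (gauge_sing x) then gauge_normal 0 else gauge_normal x.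

Lemma gauss_mapP x : Omega (gauss_map x).
Proof. by rewrite /gauss_map; case: pselect => /= _; exact: gauge_normalP. Qed.

(** Off [gauge_sing] the normal lies in a closed set [C] exactly when the maximum over the part of
    [Omega] in [C] equals the maximum over [Omega]: an equality of two continuous gauges, hence a
    closed condition. *)
Lemma measurable_gauss_map : measurable_fun setT (gauss_map : V -> V).
Proof.
apply: (@measurability _ _ V V setT gauss_map (@open 'rV[R]_n) erefl) => _ [U oU <-].
rewrite setTI -[X in measurable X]setCK; apply: measurableC.
set C := ~` (U : set 'rV[R]_n); have cC : closed C by exact: open_closedC.
rewrite (_ : ~` _ = (gauge_sing `&` [set _ | C (gauge_normal 0)]) `|`
    ([set x : V | C (gauge_normal x)] `\` gauge_sing)); last first.
  apply/seteqP; split => x /=.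
    by rewrite /gauss_map; case: pselect => /= xS; [left|right].
  by rewrite /gauss_map; case: pselect => /= xS [] [].
apply: measurableU.
  apply: measurableI; first exact: measurable_gauge_sing.
  have [Cn|Cn] := pselect (C (gauge_normal 0)).
    by rewrite (_ : [set _ | _] = setT)//; apply/seteqP; split.
  by rewrite (_ : [set _ | _] = set0)//; apply/seteqP; split.
have [nC|CO0] := pselect ((C `&` Omega) !=set0); last first.
  rewrite (_ : _ `\` _ = set0)//; apply/seteqP; split => // x [/= Cx _]; apply: CO0.
  by exists (gauge_normal x); split => //; exact: gauge_normalP.
have [_ cO sO ch h0] := Oh.
have COh : gauge_dom (C `&` Omega) h.
  split=> //.
  - by rewrite setIC; exact: compact_closedI.
  - by move=> v [_ /sO].
  - by apply: continuous_subspaceW ch => v [].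
  - by move=> v [_ /h0].
pose d (x : 'rV[R]_n) := gauge (C `&` Omega) h x - p x.
rewrite (_ : _ `\` _ = [set x : V | d x = 0] `\` gauge_sing).
  apply: measurableD; last exact: measurable_gauge_sing.
  apply: closed_borelRn_measurable.
  rewrite (_ : [set _ | _] = d @^-1` [set 0])//.
  apply: preimage_closed => [x _|]; last exact: closed_eq.
  by apply: continuousB; apply: gauge_continuous.
apply/seteqP; split => x /= [Cx xS]; split => //.
  rewrite /d; apply/eqP; rewrite subr_eq0 eq_le; apply/andP; split.
    by have [v [_ Ov] ->] := gauge_attained COh x; exact: gauge_ub.
  by rewrite gauge_normalE; apply: gauge_ub => //; split => //; exact: gauge_normalP.
move: Cx; rewrite /d => /eqP; rewrite subr_eq0 => /eqP.
have [v [Cv Ov] ->] := gauge_attained COh x => /esym pv.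
by rewrite -(gauge_normal_unique xS Ov pv).
Qed.

Section Positive.
Hypothesis p_gt0 : forall x, 0 < enorm x -> 0 < p x.

Lemma gauge_enorm x : p x = enorm x * p (normalize x).
Proof.
have [x0|x0] := eqVneq (enorm x) 0.
  by rewrite x0 mul0r (enorm_eq0 x0) -(scale0r (0 : 'rV[R]_n)) (gaugeZ Oh)// mul0r.
rewrite /normalize (gaugeZ Oh) ?invr_ge0 ?enorm_ge0//.
by rewrite mulrA divff// mul1r.
Qed.

Lemma gauge_sphere_bounds : exists c C, [/\ 0 < c, 0 < C &
  forall u, sphere u -> c <= p u <= C].
Proof.
apply: compact_pos_bounds; first exact: compact_sphere.
  by apply: continuous_subspaceT; exact: gauge_continuous.
by move=> u su; apply: p_gt0; rewrite su.
Qed.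

(** A real [sup] bounds its set only if some bound exists. Here the minimum [c > 0] of the gauge on
    the sphere gives [enorm z <= c^-1] on the Wulff shape. *)
Lemma supportf_wulff_ub v y : wulff Omega h y -> dot y v <= supportf (wulff Omega h) v.
Proof.
move=> Wy; apply: ub_le_sup; last by exists y.
have [c [C [c0 C0 cC]]] := gauge_sphere_bounds.
exists (\sum_(i < n) c^-1 * `|v 0 i|) => _ [z /(wulff_gauge Oh) pz <-].
apply: ler_sum => i _; apply: le_trans (ler_norm _) _; rewrite normrM.
apply: ler_wpM2r => //; apply: le_trans (coord_le_enorm z i) _.
have [z0|z0] := eqVneq (enorm z) 0; first by rewrite z0 invr_ge0 ltW.
rewrite -[leRHS]mul1r ler_pdivlMr//; apply: le_trans pz.
rewrite gauge_enorm ler_wpM2l ?enorm_ge0//.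
have nz0 : 0 < enorm z by rewrite lt_neqAle eq_sym z0 enorm_ge0.
by have /andP[] := cC _ (sphere_normalize nz0).
Qed.

(** A normal [v] from [eta] is not known to belong to [Omega], so it is compared through
    subgradients: [v] over its support value and the chosen normal over its [h] both support [p] at
    [x], and agree off [gauge_sing]. Conversely, the support value at the chosen normal equals [h]
    there, being attained at the boundary point in direction [x]. *)
Lemma Rstar_gauss_map (eta : set 'rV[R]_n) x : eta `<=` @sphere R n ->
  ~ gauge_sing x -> 0 < enorm x ->
  Rstar (wulff Omega h) eta (normalize x) <-> eta (gauss_map x).
Proof.
move=> se xS x0; set u := normalize x.
have [_ _ sO _ h0] := Oh.
have su : sphere u by exact: sphere_normalize.
have pu : 0 < p u by apply: p_gt0; rewrite su.
have gE : gauss_map x = gauge_normal x by rewrite /gauss_map; case: pselect.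
have On := gauge_normalP x.
have xE : x = enorm x *: u by rewrite /u /normalize scalerA divff ?scale1r// gt_eqF.
rewrite gE /Rstar /= (radial_wulff Oh pu); split => [[_ [v ev ve]]|en].
  have sv := se _ ev.
  have pv : 0 < p v by apply: p_gt0; rewrite sv.
  have hv : 0 < supportf (wulff Omega h) v.
    apply: lt_le_trans (supportf_wulff_ub v (_ : wulff Omega h ((p v)^-1 *: v))).
      by rewrite dotZl (sphere_dot sv) mulr1 invr_gt0.
    by apply/(wulff_gauge Oh); rewrite (gaugeZ Oh) ?mulVf ?gt_eqF// invr_ge0 ltW.
  suff -> : gauge_normal x = v by [].
  apply/esym.
  apply: (@sphere_scale_inj _ _ _ _ (supportf (wulff Omega h) v)^-1 (h (gauge_normal x))^-1) => //.
  - exact: sO.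
  - by rewrite invr_gt0.
  - by rewrite invr_gt0 h0.
  apply: (subgradient_unique xS).
  - move=> y; rewrite dotZr mulrC ler_pdivrMr//.
    have [y0|y0] := eqVneq (enorm y) 0.
      by rewrite (enorm_eq0 y0) -(scale0r (0 : 'rV[R]_n)) dotZl (gaugeZ Oh)// !mul0r.
    have py : 0 < p y by apply: p_gt0; rewrite lt_neqAle eq_sym y0 enorm_ge0.
    (* The boundary point in direction [y] turns the support bound into [dot y v <= p y * supportf
       (wulff Omega h) v]. *)
    have := supportf_wulff_ub v (_ : wulff Omega h ((p y)^-1 *: y)).
    rewrite dotZl mulrC ler_pdivrMr// [_ * p y]mulrC; apply.
    by apply/(wulff_gauge Oh); rewrite (gaugeZ Oh) ?mulVf ?gt_eqF// invr_ge0 ltW.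
  - exact: gauge_subgradient.
  - have xd : dot x v = enorm x * dot u v by rewrite {1}xE dotZl.
    rewrite dotZr -ve [RHS]gauge_enorm xd -/u.
    have du : dot u v != 0.
      by apply/eqP => d0; move: hv; rewrite -ve d0 mulr0 ltxx.
    by field; rewrite gt_eqF.
  - by rewrite dotZr [RHS]gauge_normalE mulrC.
split => //; exists (gauge_normal x) => //.
have hn := h0 _ On; set v := gauge_normal x in On en hn *.
have puE : p u = dot u v / h v.
  have xd : dot x v = enorm x * dot u v by rewrite {1}xE dotZl.
  have := gauge_normalE x; rewrite -/v gauge_enorm -/u xd -mulrA.
  by move/(mulfI (lt0r_neq0 x0)).
have dE : (p u)^-1 * dot u v = h v.
  have : dot u v = p u * h v by rewrite puE mulfVK// gt_eqF.
  by move->; rewrite mulKf// gt_eqF.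
rewrite dE; apply/eqP; rewrite eq_le; apply/andP; split.
  rewrite -[leLHS]dE -dotZl; apply: supportf_wulff_ub.
  by apply/(wulff_gauge Oh); rewrite (gaugeZ Oh) ?mulVf ?gt_eqF// invr_ge0 ltW.
apply: ge_sup; last by move=> _ [y Wy <-]; exact: Wy.
exists (dot 0 v), 0 => //; apply/(wulff_gauge Oh).
by rewrite -(scale0r (0 : 'rV[R]_n)) (gaugeZ Oh)// mul0r.
Qed.

End Positive.
End GaugeNormal.

(** * Logarithmic variation of the gauge *)

(** If [p x <= 0], every [dot x v] is nonpositive, and the unit vector opposite to [x] is the pole
    of a closed hemisphere containing [Omega]. *)
Lemma gauge_gt0 (R : realType) (n : nat) (Omega : set 'rV[R]_n) (h : 'rV[R]_n -> R) :
  gauge_dom Omega h ->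
  ~ (exists2 w, @sphere R n w & forall v, Omega v -> 0 <= dot v w) ->
  forall x, 0 < enorm x -> 0 < gauge Omega h x.
Proof.
move=> Oh hemi x x0; rewrite ltNge; apply/negP => px; apply: hemi.
have [_ _ _ _ h0] := Oh.
exists (- (enorm x)^-1 *: x).
  by rewrite /sphere /= enormZ normrN gtr0_norm ?invr_gt0// mulVf// gt_eqF.
move=> v Ov; rewrite dotZr mulNr oppr_ge0 dotC.
have := le_trans (gauge_ub Oh x Ov) px; rewrite pmulr_lle0 ?invr_gt0 ?h0// => xv.
by rewrite pmulr_rle0 ?invr_gt0.
Qed.

Section LogFamily.
Variables (R : realType) (n : nat) (Omega : set 'rV[R]_n) (h0 f : 'rV[R]_n -> R).
Variables (h o : R -> 'rV[R]_n -> R) (delta : R).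
Hypothesis delta_gt0 : 0 < delta.
Hypothesis Oh0 : gauge_dom Omega h0.
Hypothesis Oh : forall t, `|t| < delta -> gauge_dom Omega (h t).
Hypothesis hE : forall t, `|t| < delta -> forall v, Omega v ->
  h t v = h0 v * expR (t * f v + o t v).
Hypothesis cf : {within Omega, continuous f}.
Hypothesis o_small : forall e : R, 0 < e -> exists2 d : R, 0 < d &
  forall t, 0 < `|t| < d -> `|t| < delta -> forall v, Omega v -> `|o t v / t| < e.
Local Notation p0 := (gauge Omega h0).
Local Notation pt t := (gauge Omega (h t)).

(* Comparing each gauge with the value of the other one at its own maximiser. *)
Lemma ln_gauge_sandwich t y v0 v1 : `|t| < delta -> 0 < p0 y ->
  Omega v0 -> p0 y = dot y v0 / h0 v0 -> Omega v1 -> pt t y = dot y v1 / h t v1 ->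
  [/\ 0 < pt t y, 0 < dot y v1 / h0 v1,
      ln (pt t y) = ln (dot y v1 / h0 v1) - (t * f v1 + o t v1) &
      t * f v1 + o t v1 <= ln (p0 y) - ln (pt t y) <= t * f v0 + o t v0].
Proof.
move=> td py O0 E0 O1 E1.
have [_ _ _ _ h0_gt0] := Oh0; have [_ _ _ _ ht_gt0] := Oh td.
have lo : p0 y * expR (- (t * f v0 + o t v0)) <= pt t y.
  apply: le_trans (gauge_ub (Oh td) y O0).
  by rewrite (hE td O0) E0 expRN invfM mulrA.
have pty : 0 < pt t y by apply: lt_le_trans lo; rewrite mulr_gt0 ?expR_gt0.
have E1' : pt t y = dot y v1 / h0 v1 * expR (- (t * f v1 + o t v1)).
  by rewrite E1 (hE td O1) expRN invfM mulrA.
have y1 : 0 < dot y v1 / h0 v1.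
  by move: pty; rewrite E1' pmulr_lgt0 ?expR_gt0.
have L1 : ln (pt t y) = ln (dot y v1 / h0 v1) - (t * f v1 + o t v1).
  by rewrite E1' lnM ?posrE ?expR_gt0// expRK.
split => //; apply/andP; split.
  have : ln (dot y v1 / h0 v1) <= ln (p0 y) by rewrite ler_ln ?posrE// gauge_ub.
  by rewrite L1; lra.
have : ln (p0 y * expR (- (t * f v0 + o t v0))) <= ln (pt t y).
  by rewrite ler_ln ?posrE// mulr_gt0 ?expR_gt0.
by rewrite lnM ?posrE ?expR_gt0// expRK; lra.
Qed.

Lemma log_family_bound : exists K d, [/\ 0 <= K, 0 < d, d <= delta &
  forall t, 0 < `|t| < d -> forall v, Omega v -> `|t * f v + o t v| <= K * `|t|].
Proof.
have [nO cO _ _ _] := Oh0.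
have cnf : {within Omega, continuous (fun v => `|f v|)}.
  move=> v; apply: (@continuous_comp _ _ _ (from_subspace Omega f) (fun r : R => `|r|)); first exact: cf.
  exact: norm_continuous.
have [w /set_mem Ow wM] := compact_EVT_max nO cO cnf.
have [d d0 dM] := o_small ltr01.
(* The summand 1 absorbs [o t v / t], which is below 1 for [|t| < d]. *)
exists (`|f w| + 1), (Num.min d delta); split.
- by rewrite addr_ge0.
- by rewrite lt_min d0.
- by rewrite ge_min lexx orbT.
move=> t /andP[t0]; rewrite lt_min => /andP[td tdelta] v Ov.
have tn0 : t != 0 by rewrite -normr_gt0.
apply: le_trans (ler_normD _ _) _; rewrite mulrDl mul1r normrM mulrC lerD//.
  by rewrite ler_wpM2r// wM// inE.
have := dM t; rewrite t0 td => /(_ isT tdelta v Ov) /ltW.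
by rewrite normrM normfV ler_pdivrMr ?mul1r.
Qed.

(** Uniformity in [y] is the point: it later dominates the difference quotients of the densities. *)
Lemma ln_gauge_bound : exists K d, [/\ 0 <= K, 0 < d, d <= delta &
  forall t y, 0 < `|t| < d -> 0 < p0 y ->
    0 < pt t y /\ `|ln (p0 y) - ln (pt t y)| <= K * `|t|].
Proof.
have [K [d [K0 d0 dd Kd]]] := log_family_bound.
exists K, d; split => // t y td py.
have tdelta : `|t| < delta by case/andP: td => _ /lt_le_trans; apply.
have [v0 O0 E0] := gauge_attained Oh0 y; have [v1 O1 E1] := gauge_attained (Oh tdelta) y.
have [pty _ _ /andP[a1 a0]] := ln_gauge_sandwich tdelta py O0 E0 O1 E1.
split => //; rewrite ler_norml; apply/andP; split.
  by apply: le_trans a1; have := Kd t td _ O1; rewrite ler_norml => /andP[].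
by apply: (le_trans a0); have := Kd t td _ O0; rewrite ler_norml => /andP[].
Qed.

(** The points of [Omega] where [f] is at least [e] away from [f v0] form a compact set avoiding the
    unique maximiser, so the maximum [q0] over it is strictly below [p0 y]. For small [t] the
    perturbation of the logarithms cannot close this gap. Closeness of the [f] values suffices; [v1]
    itself is not estimated. *)
Lemma maximiser_near y v0 (e : R) : 0 < e -> 0 < p0 y -> Omega v0 ->
  (forall v, Omega v -> p0 y = dot y v / h0 v -> v = v0) ->
  exists2 d, 0 < d & forall t v1, 0 < `|t| < d -> `|t| < delta -> Omega v1 ->
    pt t y = dot y v1 / h t v1 -> `|f v1 - f v0| < e.
Proof.
move=> e0 py O0 uniq.
have [v0' O0' E0] := gauge_attained Oh0 y.
have ? := uniq _ O0' E0; subst v0'.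
have [_ cO sO ch h0_gt0] := Oh0.
have [K [d [K0 d0 dd Kd]]] := log_family_bound.
(* [f] is continuous on [Omega] only, so the bad set is closed relative to [Omega]; [A] is a closed
   set with that trace. *)
have [A cA AE] : exists2 A : set 'rV[R]_n, closed A &
    A `&` Omega = [set v | e <= `|f v - f v0|] `&` Omega.
  apply/closed_subspaceP.
  rewrite (_ : [set v | _] = from_subspace Omega f @^-1` [set r : R | e <= `|r - f v0|])//.
  apply: preimage_closed => [v _|]; first exact: cf.
  rewrite (_ : [set r : R | _] = (fun r : R => `|r - f v0|) @^-1` [set r : R | e <= r])//.
  apply: preimage_closed => [r _|]; last exact: closed_ge.
  apply: (@continuous_comp _ _ _ (fun r : R => r - f v0) (fun r : R => `|r|)).
    by apply: continuousB; [exact: cvg_id|exact: cst_continuous].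
  exact: norm_continuous.
have [nA|nA] := pselect ((A `&` Omega) !=set0); last first.
  exists delta => // t v1 _ _ O1 _; rewrite ltNge; apply/negP => ef; apply: nA.
  by exists v1; rewrite AE.
have AOh : gauge_dom (A `&` Omega) h0.
  split=> //.
  - by rewrite setIC; exact: compact_closedI.
  - by move=> v [_ /sO].
  - by apply: continuous_subspaceW ch => v [].
  - by move=> v [_ /h0_gt0].
have [w AOw Ew] := gauge_attained AOh y.
have Ow : Omega w by case: AOw.
have wlt : dot y w / h0 w < p0 y.
  rewrite lt_neqAle gauge_ub// andbT; apply/eqP => /esym/(uniq _ Ow) wv.
  move: AOw; rewrite AE => -[/=]; rewrite wv subrr normr0 => /le_lt_trans/(_ e0).
  by rewrite ltxx.
pose q0 := dot y w / h0 w.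
(* When [q0 <= 0] its logarithm is meaningless, but then no bad point can be a maximiser for [h t],
   whose ratio must be positive. *)
have [q00|q00] := leP q0 0.
  exists delta => // t v1 _ td O1 E1; rewrite ltNge; apply/negP => ef.
  have [_ y1 _ _] := ln_gauge_sandwich td py O0 E0 O1 E1.
  have : dot y v1 / h0 v1 <= q0.
    by rewrite /q0 -Ew; apply: gauge_ub => //; rewrite AE.
  by rewrite leNgt (le_lt_trans q00).
have ln_lt : 0 < ln (p0 y) - ln q0 by rewrite subr_gt0 ltr_ln ?posrE.
(* A bad maximiser would force [ln (p0 y) - ln q0 <= 2 * K * |t|], one [K * |t|] from each of [v0]
   and [v1]; the extra 1 keeps the denominator positive when [K = 0]. *)
exists (Num.min d ((ln (p0 y) - ln q0) / (2 * K + 1))).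
  by rewrite lt_min d0 divr_gt0// ltr_wpDl// mulr_ge0.
move=> t v1 /andP[t0]; rewrite lt_min => /andP[td tq] tdelta O1 E1.
rewrite ltNge; apply/negP => ef.
have [pty y1 L1 /andP[_ a0]] := ln_gauge_sandwich tdelta py O0 E0 O1 E1.
have yq : ln (dot y v1 / h0 v1) <= ln q0.
  by rewrite ler_ln ?posrE// /q0 -Ew; apply: gauge_ub => //; rewrite AE.
have t0d : 0 < `|t| < d by rewrite t0.
have := Kd t t0d _ O1; have := Kd t t0d _ O0; rewrite !ler_norml => /andP[_ b0] /andP[b1 _].
move: tq; rewrite ltr_pdivlMr; last by rewrite ltr_wpDl// mulr_ge0.
rewrite mulrDr mulr1 mulrCA => tq.
by move: a0 b0 b1 yq tq t0; rewrite L1 [`|t| * K]mulrC; lra.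
Qed.

Lemma ln_gauge_derivative y v0 (e : R) : 0 < e -> 0 < p0 y -> Omega v0 ->
  (forall v, Omega v -> p0 y = dot y v / h0 v -> v = v0) ->
  exists2 d, 0 < d & forall t, 0 < `|t| < d -> `|t| < delta ->
    `|(ln (p0 y) - ln (pt t y)) / t - f v0| < e.
Proof.
move=> e0 py O0 uniq; have e20 : 0 < e / 2 by rewrite divr_gt0.
have [d d0 dP] := maximiser_near e20 py O0 uniq.
have [d' d'0 d'P] := o_small e20.
have [v0' O0' E0] := gauge_attained Oh0 y.
have ? := uniq _ O0' E0; subst v0'.
exists (Num.min d d'); first by rewrite lt_min d0.
move=> t /andP[t0]; rewrite lt_min => /andP[td td'] tdelta.
have [v1 O1 E1] := gauge_attained (Oh tdelta) y.
have [_ _ _ /andP[a1 a0]] := ln_gauge_sandwich tdelta py O0 E0 O1 E1.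
have f1 : `|f v1 - f v0| < e / 2 by apply: (dP t) => //; rewrite t0.
have t0d' : 0 < `|t| < d' by rewrite t0.
have o0 := d'P t t0d' tdelta _ O0; have o1 := d'P t t0d' tdelta _ O1.
have tn0 : t != 0 by rewrite -normr_gt0.
have E v : (t * f v + o t v) / t = f v + o t v / t by rewrite mulrDl mulrAC divff// mul1r.
(* Division by a negative [t] reverses the sandwich, hence the two orders. *)
have : (f v1 + o t v1 / t <= (ln (p0 y) - ln (pt t y)) / t <= f v0 + o t v0 / t) ||
       (f v0 + o t v0 / t <= (ln (p0 y) - ln (pt t y)) / t <= f v1 + o t v1 / t).
  rewrite -!E; have [tp|tm|t00] := ltgtP 0 t.
  - by rewrite !ler_pM2r ?invr_gt0// a1 a0.
  - by rewrite !ler_nM2r ?invr_lt0// a1 a0 orbT.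
  - by move: tn0; rewrite -t00 eqxx.
move: f1 o0 o1; rewrite !ltr_norml => /andP[? ?] /andP[? ?] /andP[? ?].
by case/orP => /andP[? ?]; apply/andP; split; lra.
Qed.

End LogFamily.

(** * First-order estimates for the exponential at 0 *)

Lemma expR_sub1_bounds (R : realType) (z : R) : z <= expR z - 1 <= z * expR z.
Proof.
have h1 : z <= expR z - 1 by have := expR_ge1Dx z; lra.
(* The upper bound is [1 - z <= expR (- z)] multiplied by [expR z]. *)
rewrite h1 /=; have := expR_ge1Dx (- z).
rewrite expRN -(ler_pM2r (expR_gt0 z)) mulVf ?gt_eqF ?expR_gt0// mulrBl mul1r.
by lra.
Qed.

Lemma norm_expR_sub1 (R : realType) (z : R) : `|expR z - 1| <= `|z| * expR `|z|.
Proof.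
have /andP[h1 h2] := expR_sub1_bounds z.
have e1 : 1 <= expR `|z| by rewrite -expR0 ler_expR.
have [z0|z0] := leP 0 z.
  have ez : 0 <= expR z - 1 by exact: le_trans h1.
  by rewrite !ger0_norm.
have ez : expR z <= 1 by rewrite -expR0 ler_expR ltW.
rewrite ler0_norm; last by rewrite subr_le0.
by rewrite opprB; move: e1; rewrite ltr0_norm// => e1; nra.
Qed.

(** The remainder [expR z - 1 - z] lies between 0 and [z * (expR z - 1)]. This avoids dividing by
    [z k], which may vanish. *)
Lemma cvg_expR_sub1_div (R : realType) (u z : R^nat) (l : R) :
  (forall k, u k != 0) -> z @ \oo --> 0 -> (fun k => z k / u k) @ \oo --> l ->
  (fun k => (expR (z k) - 1) / u k) @ \oo --> l.
Proof.
move=> u0 z0 zu.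
have ez : (fun k => expR (z k)) @ \oo --> (1 : R).
  by rewrite -(@expR0 R); apply: continuous_cvg => //; exact: continuous_expR.
have e0 : (fun k => `|z k / u k| * `|expR (z k) - 1|) @ \oo --> 0.
  rewrite [X in _ --> X](_ : _ = `|l| * `|1 - 1|); last by rewrite subrr normr0 mulr0.
  by apply: cvgM; apply: cvg_norm => //; apply: cvgB => //; exact: cvg_cst.
have d0 : (fun k => (expR (z k) - 1) / u k - z k / u k) @ \oo --> 0.
  apply/norm_cvg0P; apply: (squeeze_cvgr (f := cst 0)) (cvg_cst _) e0.
  apply: nearW => k; rewrite normr_ge0 /= -mulrBl normrM.
  rewrite normrM mulrAC ler_wpM2r//.
  have /andP[h1 h2] := expR_sub1_bounds (z k).
  rewrite ger0_norm; last by rewrite subr_ge0.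
  rewrite -normrM; apply: le_trans (ler_norm _).
  by rewrite mulrBr mulr1; lra.
rewrite -[l]add0r; rewrite (_ : (fun k => _) = (fun k =>
  ((expR (z k) - 1) / u k - z k / u k) + z k / u k)); first exact: cvgD.
by apply/funext => k; rewrite subrK.
Qed.

(** * Spherical integrals *)

Section WeightedPushforward.
Context d (T : measurableType d) (R : realType) (nu : {measure set T -> \bar R}).
Context d' (T' : measurableType d') (mu : {measure set T' -> \bar R}).
Variables (w : T -> R) (a : T -> T').
Hypotheses (mw : measurable_fun setT w) (w0 : forall x, 0 <= w x).
Hypothesis ma : measurable_fun setT a.
Hypothesis muE : forall A, measurable A -> mu A = (\int[nu]_x (w x * \1_A (a x))%:E)%E.

Let mwg (g : T' -> \bar R) : measurable_fun setT g ->
  measurable_fun setT (fun x => (w x)%:E * g (a x))%E.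
Proof.
move=> mg; apply: emeasurable_funM; first exact/measurable_EFinP.
exact: (measurableT_comp mg ma).
Qed.

(** The measure [mu] is known only through its values on measurable sets; this turns integrals
    against it into integrals against [nu]. *)
Lemma ge0_integral_weighted_pushforward (g : T' -> \bar R) :
  measurable_fun setT g -> (forall y, 0 <= g y)%E ->
  (\int[mu]_y g y = \int[nu]_x ((w x)%:E * g (a x)))%E.
Proof.
have wg0 (k : T' -> \bar R) : (forall y, 0 <= k y)%E -> forall x, (0 <= (w x)%:E * k (a x))%E.
  by move=> k0 x; rewrite mule_ge0// lee_fin.
move=> mg g0; apply/esym.
apply: (@ge0_functional_integral _ _ _ mu
  (fun g : T' -> \bar R => \int[nu]_x ((w x)%:E * g (a x)))%E) => //.
- move=> f k mf f0 mk k0; rewrite -ge0_integralD//=; last 4 first.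
  + by move=> x _; exact: wg0.
  + exact: mwg.
  + by move=> x _; exact: wg0.
  + exact: mwg.
  by apply: eq_integral => x _; rewrite muleDr// ge0_adde_def// inE.
- move=> c k c0 mk k0; rewrite -ge0_integralZl//=; last 2 first.
  + exact: mwg.
  + by move=> x _; exact: wg0.
  by apply: eq_integral => x _; rewrite muleCA.
- move=> k mk k0 ndk; rewrite -monotone_convergence//; last 3 first.
  + by move=> m; exact: mwg.
  + by move=> m x _; exact: wg0.
  + by move=> x _ m m' mm'; rewrite lee_wpmul2l// ?lee_fin//; exact: ndk.
  apply: eq_integral => x _; apply/esym/cvg_lim => //.
  by apply: cvgeZl => //; apply: ereal_nondecreasing_is_cvgn; exact: ndk.
- by move=> A mA; rewrite muE//; apply: eq_integral => x _.
Qed.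

Lemma integral_weighted_pushforward (g : T' -> R) : measurable_fun setT g ->
  (\int[mu]_y (g y)%:E = \int[nu]_x (w x * g (a x))%:E)%E.
Proof.
move=> mg; have mEg : measurable_fun setT (fun y => (g y)%:E) by exact/measurable_EFinP.
rewrite integralE [RHS]integralE; congr (_ - _)%E.
- rewrite ge0_integral_weighted_pushforward//; last exact: measurable_funepos.
  apply: eq_integral => x _; rewrite !funeposE EFinM.
  by rewrite maxe_pMr ?lee_fin// mule0.
- rewrite ge0_integral_weighted_pushforward//; last exact: measurable_funeneg.
  apply: eq_integral => x _; rewrite !funenegE EFinM.
  by rewrite maxe_pMr ?lee_fin// mule0 muleN.
Qed.

End WeightedPushforward.

Section SphericalIntegral.
Variables (R : realType) (n : nat).
Local Notation V := (borelRn R n).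
Local Notation leb := (@lebRn R n).

Definition punctured_ball : set V := [set x : 'rV[R]_n | (0 < enorm x) && (enorm x <= 1)].

Lemma measurable_enorm : measurable_fun setT (@enorm R n : V -> R).
Proof.
apply: continuous_borelRn_measurable => //.
by apply: continuous_subspaceT; exact: enorm_continuous.
Qed.

Lemma measurable_normalize : measurable_fun setT (@normalize R n : V -> V).
Proof.
apply: measurable_to_borelRn => i.
(* On nonnegative numbers the inverse is the power [-1], including the value 0 at 0, and powers are
   measurable on the whole line. *)
rewrite (_ : (fun _ => _) = (fun x : V => (enorm (x : 'rV[R]_n)) `^ (-1) * (x : 'rV[R]_n) 0 i)).
  apply: measurable_funM; last exact: measurable_coord.
  exact: (measurableT_comp (measurable_powR (-1)) measurable_enorm).
by apply/funext => x; rewrite mxE powR_inv1// enorm_ge0.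
Qed.

Lemma measurable_punctured_ball : measurable punctured_ball.
Proof.
rewrite (_ : punctured_ball = (@enorm R n : V -> R) @^-1` `]0, 1]%classic); last first.
  by apply/seteqP; split => x /=; rewrite in_itv.
by rewrite -[X in measurable X]setTI; exact: measurable_enorm.
Qed.

Lemma measurable_cube : measurable [set x : V | forall i, (`|(x : 'rV[R]_n) 0 i| <= 1)%R].
Proof.
rewrite (_ : [set _ | _] = \bigcap_(i in [set: 'I_n])
    ((fun x : V => (x : 'rV[R]_n) 0 i : R) @^-1` `[-1, 1]%classic)).
  apply: fin_bigcap_measurable => // i _.
  by rewrite -[X in measurable X]setTI; exact: measurable_coord.
apply/seteqP; split => x /= H i; first by move=> _; rewrite /= in_itv /= -ler_norml.
by have := H i I; rewrite /= in_itv /= -ler_norml.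
Qed.

Lemma integrable_ball (g : V -> R) (C : R) : measurable_fun setT g ->
  (forall x, ~ punctured_ball x -> g x = 0) -> (forall x, `|g x| <= C) ->
  leb.-integrable setT (EFin \o g).
Proof.
move=> mg gB gC; have C0 : 0 <= C by exact: le_trans (gC 0).
set A := [set x : V | forall i, (`|(x : 'rV[R]_n) 0 i| <= 1)%R].
have mA : measurable A by exact: measurable_cube.
have mI : measurable_fun setT (fun x : V => (\1_A x)%:E : \bar R).
  by apply/measurable_EFinP; exact: measurable_indic.
apply: (@le_integrable _ _ _ _ _ _ _ (fun x => C%:E * (\1_A x)%:E)%E) => //.
- exact/measurable_EFinP.
- move=> x _ /=; rewrite lee_fin.
  have [Bx|Bx] := pselect (punctured_ball x); last by rewrite gB// normr0.
  rewrite indicE mem_set ?mulr1.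
    by apply: le_trans (gC x) _; exact: ler_norm.
  by move=> i; apply: le_trans (coord_le_enorm x i) _; case/andP: Bx.
- apply/integrableP; split; first exact: measurable_funeM.
  under eq_integral.
    move=> x _; rewrite gee0_abs; last by rewrite mule_ge0// lee_fin.
    over.
  rewrite ge0_integralZl// integral_indic// setIT.
  by rewrite lte_mul_pinfty// ?lee_fin//; exact: lebRn_cube_lty.
Qed.

Lemma sphint_integral (g : 'rV[R]_n -> \bar R) (D : V -> R) :
  measurable_fun setT D -> (forall x, 0 <= D x) ->
  (forall x : 'rV[R]_n, (if (0 < enorm x) && (enorm x <= 1) then g (normalize x) else 0%E)
     = (D x)%:E) ->
  sphint g = (n%:R%:E * \int[leb]_x (D x)%:E)%E.
Proof.
move=> mD D0 gD; rewrite /sphint; congr (_ * _)%E.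
rewrite -lebint_integral//; last exact/measurable_EFinP.
by congr lebint; apply/funext => x; rewrite gD.
Qed.

End SphericalIntegral.

Lemma expR_ln_bound (R : realType) (a c C r : R) : 0 < c -> c <= r <= C ->
  expR (a * ln r) <= expR (`|a| * (`|ln c| + `|ln C|)).
Proof.
move=> c0 /andP[cr rC]; have r0 : 0 < r by exact: lt_le_trans cr.
have C0 : 0 < C by exact: lt_le_trans rC.
rewrite ler_expR; apply: le_trans (ler_norm _) _; rewrite normrM ler_wpM2l//.
have h1 : ln c <= ln r by rewrite ler_ln.
have h2 : ln r <= ln C by rewrite ler_ln.
have := ler_norm (ln C); have := lerNnormlW (lexx `|ln c|).
have := normr_ge0 (ln c); have := normr_ge0 (ln C).
by rewrite ler_norml => *; apply/andP; split; lra.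
Qed.

(** * Densities of the dual quantities on the punctured ball *)

Section RadialWeight.
Variables (R : realType) (n : nat) (Q : set 'rV[R]_n) (c : R).
Hypothesis Q_gt0 : forall u, @sphere R n u -> 0 < radial Q u.
Hypothesis cQ : {within @sphere R n, continuous (radial Q)}.
Local Notation V := (borelRn R n).

Definition radial_weight (x : V) : R :=
  if (0 < enorm (x : 'rV[R]_n)) && (enorm (x : 'rV[R]_n) <= 1)
  then radial Q (normalize x) `^ c else 0.

Lemma radial_weight_out x : ~ @punctured_ball R n x -> radial_weight x = 0.
Proof. by rewrite /punctured_ball /= /radial_weight => /negP/negbTE ->. Qed.

Lemma measurable_radial_weight : measurable_fun setT radial_weight.
Proof.
have cS : closed (@sphere R n).
  by apply: compact_closed; [exact: norm_hausdorff|exact: compact_sphere].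
have mS : measurable (@sphere R n : set V) by exact: closed_borelRn_measurable.
(* [radial Q] is controlled on the sphere only, so it is cut off to 0 elsewhere before composing
   with [normalize]. *)
have mQ : measurable_fun setT (radial Q \_ (@sphere R n) : V -> R).
  by apply/(measurable_restrictT _ mS); exact: continuous_borelRn_measurable.
rewrite (_ : radial_weight = (fun x : V => \1_(@punctured_ball R n) x *
    ((radial Q \_ (@sphere R n)) (normalize x)) `^ c)).
  apply: measurable_funM; first by apply: measurable_indic; exact: measurable_punctured_ball.
  apply: (measurableT_comp (measurable_powR c)).
  exact: (measurableT_comp mQ (@measurable_normalize R n)).
apply/funext => x; rewrite /radial_weight indicE.
case: ifPn => [Bx|/negP Bx]; last by rewrite memNset// mul0r.
rewrite mem_set// mul1r patchE mem_set//.
by apply: sphere_normalize; case/andP: Bx.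
Qed.

Lemma radial_weight_bound : exists C, forall x, 0 <= radial_weight x <= C.
Proof.
have [a [A [a0 A0 aA]]] := compact_pos_bounds (@compact_sphere R n) cQ Q_gt0.
exists (expR (`|c| * (`|ln a| + `|ln A|))) => x; rewrite /radial_weight.
case: ifP => [/andP[x0 _]|_]; last by rewrite lexx expR_ge0.
have sx := sphere_normalize x0.
by rewrite /powR gt_eqF ?Q_gt0// expR_ge0 expR_ln_bound// aA.
Qed.

Section Density.
Variables (q : R) (Omega : set 'rV[R]_n) (h : 'rV[R]_n -> R).
Hypothesis Oh : gauge_dom Omega h.
Hypothesis p_gt0 : forall x, 0 < enorm x -> 0 < gauge Omega h x.

(** The integrand [rho^q * rho_Q^c] of the cone formula. Written with [expR], a change of the gauge
    becomes an additive change of the exponent. *)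
Definition dual_density (x : V) : R :=
  radial_weight x * expR (- q * ln (gauge Omega h (normalize x))).

Lemma dual_density_out x : ~ @punctured_ball R n x -> dual_density x = 0.
Proof. by move=> Bx; rewrite /dual_density radial_weight_out// mul0r. Qed.

Lemma dual_density_ge0 x : 0 <= dual_density x.
Proof.
have [C /(_ x)/andP[w0 _]] := radial_weight_bound.
by rewrite mulr_ge0// expR_ge0.
Qed.

Lemma measurable_dual_density : measurable_fun setT dual_density.
Proof.
apply: measurable_funM; first exact: measurable_radial_weight.
have mp : measurable_fun setT (gauge Omega h : V -> R).
  by apply: continuous_borelRn_measurable => //; apply: continuous_subspaceT; exact: gauge_continuous.
apply: (measurableT_comp (@measurable_expR R)); apply: measurable_funM => //.
apply: (measurableT_comp (@measurable_ln R)).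
exact: (measurableT_comp mp (@measurable_normalize R n)).
Qed.

Lemma dual_density_bound : exists C, forall x, `|dual_density x| <= C.
Proof.
have [C wC] := radial_weight_bound.
have [a [A [a0 A0 aA]]] := gauge_sphere_bounds Oh p_gt0.
exists (C * expR (`|- q| * (`|ln a| + `|ln A|))) => x.
have [Bx|Bx] := pselect (@punctured_ball R n x); last first.
  have /andP[w0 wC0] := wC x.
  by rewrite dual_density_out// normr0 mulr_ge0 ?expR_ge0// (le_trans w0).
have /andP[w0 wC0] := wC x.
rewrite ger0_norm ?dual_density_ge0// ler_pM ?expR_ge0//.
by apply: expR_ln_bound => //; apply: aA; apply: sphere_normalize; case/andP: Bx.
Qed.

Lemma integrable_dual_density : (@lebRn R n).-integrable setT (EFin \o dual_density).
Proof.
have [C dC] := dual_density_bound.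
by apply: (integrable_ball measurable_dual_density _ dC); exact: dual_density_out.
Qed.

Lemma dual_densityE (x : 'rV[R]_n) : 0 < enorm x -> enorm x <= 1 ->
  (radial (wulff Omega h) (normalize x)) `^ q * (radial Q (normalize x)) `^ c = dual_density x.
Proof.
move=> x0 x1; have sx := sphere_normalize x0.
have px : 0 < gauge Omega h (normalize x) by apply: p_gt0; rewrite sx.
rewrite /dual_density /radial_weight x0 x1 /= mulrC (radial_wulff Oh px); congr (_ * _).
by rewrite /powR gt_eqF ?invr_gt0// lnV ?posrE// mulrN mulNr.
Qed.

End Density.
End RadialWeight.

Lemma Wtilde_wulff (R : realType) (n : nat) (Q : set 'rV[R]_n) (q j : R)
  (Omega : set 'rV[R]_n) (h : 'rV[R]_n -> R) : (0 < n)%N ->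
  (forall u, @sphere R n u -> 0 < radial Q u) ->
  {within @sphere R n, continuous (radial Q)} ->
  gauge_dom Omega h -> (forall x, 0 < enorm x -> 0 < gauge Omega h x) ->
  Wtilde q j (wulff Omega h) Q =
    (\int[@lebRn R n]_x dual_density Q (n%:R - q - j) q Omega h x)%R.
Proof.
move=> n0 Q0 cQ Oh p0; rewrite /Wtilde.
have id := integrable_dual_density (n%:R - q - j) Q0 cQ q Oh p0.
rewrite (sphint_integral (D := dual_density Q (n%:R - q - j) q Omega h)).
- rewrite fineM ?fin_numE//; last exact: integrable_fin_num.
  by rewrite mulKf// pnatr_eq0 -lt0n.
- exact: measurable_dual_density.
- exact: dual_density_ge0.
move=> x; case: ifPn => [/andP[x0 x1]|/negP Bx].
  by rewrite (dual_densityE Q _ _ Oh p0).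
by rewrite dual_density_out.
Qed.

(* The integrand of the dual curvature measure need not be Borel, but it is squeezed
   between two Borel functions that agree off the null set [gauge_sing]. *)
Lemma Ctilde_wulff (R : realType) (n : nat) (Q : set 'rV[R]_n) (q j : R)
  (Omega : set 'rV[R]_n) (h : 'rV[R]_n -> R) (Oh : gauge_dom Omega h)
  (eta : set (borelRn R n)) : (0 < n)%N ->
  (forall u, @sphere R n u -> 0 < radial Q u) ->
  {within @sphere R n, continuous (radial Q)} ->
  (forall x, 0 < enorm x -> 0 < gauge Omega h x) -> measurable eta ->
  Ctilde q j (wulff Omega h) Q (eta `&` @sphere R n) =
    (\int[@lebRn R n]_x (dual_density Q (n%:R - q - j) q Omega h x *
       \1_eta (gauss_map Oh x))%:E)%E.
Proof.
move=> n0 Q0 cQ p0 meta; set D := dual_density _ _ _ _ _.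
have D0 x : 0 <= D x by exact: dual_density_ge0.
have mD : measurable_fun setT D by exact: measurable_dual_density.
have [_ _ sO _ _] := Oh.
have mS := measurable_gauge_sing Oh.
have mg : measurable_fun setT (fun x : borelRn R n => \1_eta (gauss_map Oh x) : R).
  exact: (measurableT_comp (measurable_indic meta) (measurable_gauss_map Oh)).
have mN : measurable_fun setT (fun x => \1_(gauge_sing Omega h) x : R) by exact: measurable_indic.
have mDg : measurable_fun setT (fun x => D x * \1_eta (gauss_map Oh x)) by exact: measurable_funM.
have Dg0 x : 0 <= D x * \1_eta (gauss_map Oh x) by rewrite mulr_ge0.
pose lo x := D x * \1_eta (gauss_map Oh x) * (1 - \1_(gauge_sing Omega h) x).
pose up x := D x * \1_eta (gauss_map Oh x) + D x * \1_(gauge_sing Omega h) x.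
have lo0 x : 0 <= lo x.
  by rewrite mulr_ge0// subr_ge0 indicE lern1 leq_b1.
have up0 x : 0 <= up x by rewrite addr_ge0// mulr_ge0.
have mlo : measurable_fun setT lo.
  by apply: measurable_funM => //; apply: measurable_funB.
have mup : measurable_fun setT up.
  by apply: measurable_funD => //; apply: measurable_funM.
have aeE (g : borelRn R n -> R) : measurable_fun setT g -> (forall x, 0 <= g x) ->
    (forall x, ~ gauge_sing Omega h x -> g x = D x * \1_eta (gauss_map Oh x)) ->
    (\int[@lebRn R n]_x (g x)%:E = \int[@lebRn R n]_x (D x * \1_eta (gauss_map Oh x))%:E)%E.
  move=> mgg g0 gE; apply: ge0_ae_eq_integral => //.
  - exact/measurable_EFinP.
  - exact/measurable_EFinP.
  - by move=> x _; rewrite lee_fin.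
  - by move=> x _; rewrite lee_fin.
  have [N [mN' N0 sN]] := negligible_gauge_sing Oh; exists N; split => // x /= H.
  by apply: sN; apply: contrapT => xS; apply: H => _; rewrite gE.
set G : 'rV[R]_n -> \bar R := fun x => if (0 < enorm x) && (enorm x <= 1) then
  (\1_(Rstar (wulff Omega h) (eta `&` @sphere R n)) (normalize x) *
   radial (wulff Omega h) (normalize x) `^ q * radial Q (normalize x) `^ (n%:R - q - j))%:E else 0%E.
have -> : Ctilde q j (wulff Omega h) Q (eta `&` @sphere R n) = lebint G.
  rewrite /Ctilde /sphint muleA -EFinM mulVf ?mul1e// pnatr_eq0 -lt0n//.
have GE x : G x = (\1_(Rstar (wulff Omega h) (eta `&` @sphere R n)) (normalize x) * D x)%:E.
  rewrite /G; case: ifPn => [/andP[x0 x1]|/negP Bx].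
    by rewrite -mulrA (dual_densityE Q _ _ Oh p0).
  by rewrite /D dual_density_out// mulr0.
have RE x : ~ gauge_sing Omega h x ->
    \1_(Rstar (wulff Omega h) (eta `&` @sphere R n)) (normalize x) * D x
    = D x * \1_eta (gauss_map Oh x).
  move=> xS; have [/andP[x0 x1]|Bx] := pselect (@punctured_ball R n x); last first.
    by rewrite /D dual_density_out// mulr0 mul0r.
  rewrite mulrC; congr (_ * _); rewrite !indicE; congr ((nat_of_bool _)%:R).
  have := Rstar_gauss_map Oh p0 (@subIsetr _ eta (@sphere R n)) xS x0.
  move=> [H1 H2]; apply/idP/idP; rewrite !inE.
    by case/H1.
  by move=> eg; apply: H2; split => //; apply: sO; exact: gauss_mapP.
apply/eqP; rewrite eq_le; apply/andP; split.
(* Comparison takes place between iterated integrals, where [G] needs no measurability; [up] carries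
   at least the full density on [gauge_sing], and [lo] below vanishes there. *)
- rewrite -(aeE up)//; last first.
    by move=> x xS; rewrite /up [\1_(gauge_sing _ _) x]indicE memNset// mulr0 addr0.
  rewrite -lebint_integral//; last exact/measurable_EFinP.
  rewrite !lebint_iter; apply: le_iter_int => x; rewrite GE lee_fin; first by rewrite mulr_ge0.
  have [xS|xS] := pselect (gauge_sing Omega h x); last by rewrite RE// lerDl mulr_ge0.
  rewrite /up [\1_(gauge_sing _ _) x]indicE mem_set// mulr1 -[leLHS]add0r lerD//.
  by rewrite ler_piMl// indicE lern1 leq_b1.
- rewrite -(aeE lo)//; last first.
    by move=> x xS; rewrite /lo [\1_(gauge_sing _ _) x]indicE memNset// subr0 mulr1.
  rewrite -lebint_integral//; last exact/measurable_EFinP.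
  rewrite !lebint_iter; apply: le_iter_int => x; rewrite ?GE lee_fin//.
  have [xS|xS] := pselect (gauge_sing Omega h x).
    by rewrite /lo [\1_(gauge_sing _ _) x]indicE mem_set// subrr mulr0 mulr_ge0.
  by rewrite RE// /lo [\1_(gauge_sing _ _) x]indicE memNset// subr0 mulr1.
Qed.

(** * Differentiating the dual quermassintegral *)

Section Variation.
Variables (R : realType) (n : nat) (Omega : set 'rV[R]_n) (h0 f : 'rV[R]_n -> R).
Variables (h o : R -> 'rV[R]_n -> R) (delta : R) (Q : set 'rV[R]_n) (c q : R).
Hypothesis delta_gt0 : 0 < delta.
Hypothesis Oh0 : gauge_dom Omega h0.
Hypothesis Oh : forall t, `|t| < delta -> gauge_dom Omega (h t).
Hypothesis hE : forall t, `|t| < delta -> forall v, Omega v ->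
  h t v = h0 v * expR (t * f v + o t v).
Hypothesis cf : {within Omega, continuous f}.
Hypothesis o_small : forall e : R, 0 < e -> exists2 d : R, 0 < d &
  forall t, 0 < `|t| < d -> `|t| < delta -> forall v, Omega v -> `|o t v / t| < e.
Hypothesis p0_gt0 : forall x, 0 < enorm x -> 0 < gauge Omega h0 x.
Hypothesis Q_gt0 : forall u, @sphere R n u -> 0 < radial Q u.
Hypothesis cQ : {within @sphere R n, continuous (radial Q)}.
Local Notation V := (borelRn R n).
Local Notation leb := (@lebRn R n).
Local Notation D0 := (dual_density Q c q Omega h0).
Local Notation D t := (dual_density Q c q Omega (h t)).

Lemma measurable_patch_Omega : measurable_fun setT (f \_ Omega : V -> R).
Proof.
have [_ cO _ _ _] := Oh0.
have clO : closed Omega by apply: compact_closed cO; exact: norm_hausdorff.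
have mO : measurable (Omega : set V) by exact: closed_borelRn_measurable.
by apply/(measurable_restrictT _ mO); exact: continuous_borelRn_measurable.
Qed.

Lemma dual_densityB t x : D t x - D0 x =
  D0 x * (expR (q * (ln (gauge Omega h0 (normalize x)) - ln (gauge Omega (h t) (normalize x)))) - 1).
Proof.
rewrite /dual_density mulrBr mulr1 -mulrA -expRD; congr (_ * expR _ - _).
by ring.
Qed.

Lemma dual_density_quotient_cvg (u : R^nat) (x : V) :
  (forall k, u k != 0) -> u @ \oo --> 0 -> ~ gauge_sing Omega h0 x ->
  (fun k => (D (u k) x - D0 x) / u k) @ \oo --> D0 x * (q * f (gauss_map Oh0 x)).
Proof.
move=> u0 ucvg xS.
have [Bx|Bx] := pselect (@punctured_ball R n x); last first.
  rewrite dual_density_out// mul0r (_ : (fun _ => _) = cst 0); first exact: cvg_cst.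
  by apply/funext => k; rewrite dual_density_out// subrr mul0r.
have /andP[x0 x1] := Bx; set y := normalize (x : 'rV[R]_n).
have py : 0 < gauge Omega h0 y by apply: p0_gt0; rewrite (sphere_normalize x0).
pose X k := ln (gauge Omega h0 y) - ln (gauge Omega (h (u k)) y).
rewrite (_ : (fun _ => _) = (fun k => D0 x * ((expR (q * X k) - 1) / u k))); last first.
  by apply/funext => k; rewrite dual_densityB mulrA.
(* The gauge is evaluated at [y] but the normal is taken at [x]; homogeneity gives both points the
   same maximisers. *)
have uniq v : Omega v -> gauge Omega h0 y = dot y v / h0 v -> v = gauss_map Oh0 x.
  move=> Ov yv; rewrite /gauss_map; case: pselect => //= _.
  apply: gauge_normal_unique => //; rewrite (gauge_enorm Oh0) -/y yv mulrA -dotZl.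
  by rewrite /y /normalize scalerA divff ?scale1r// gt_eqF.
have Xu : (fun k => X k / u k) @ \oo --> f (gauss_map Oh0 x).
  apply/cvgrPdist_lt => e e0.
  have [d d0 dP] := ln_gauge_derivative delta_gt0 Oh0 Oh hE cf o_small e0 py (gauss_mapP Oh0 x) uniq.
  have dd0 : 0 < Num.min d delta by rewrite lt_min d0.
  move/cvgrPdist_lt: ucvg => /(_ _ dd0); apply: filterS => k.
  rewrite sub0r normrN lt_min => /andP[kd kdelta].
  by rewrite distrC; apply: dP => //; rewrite normr_gt0 u0.
have X0 : X @ \oo --> 0.
  rewrite -[X in _ --> X](mulr0 (f (gauss_map Oh0 x))) (_ : X = (fun k => X k / u k * u k)).
    exact: cvgM.
  by apply/funext => k; rewrite mulfVK.
apply: cvgMr; apply: cvg_expR_sub1_div => //.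
  by rewrite -[X in _ --> X](mulr0 q); exact: cvgMr.
by under eq_fun do rewrite -mulrA; exact: cvgMr.
Qed.

Lemma dual_density_quotient_bound : exists B d, [/\ 0 < d, d <= delta &
  forall t, 0 < `|t| < d -> forall x, `|(D t x - D0 x) / t| <= B].
Proof.
have [K [d [K0 d0 dd Kd]]] := ln_gauge_bound delta_gt0 Oh0 Oh hE cf o_small.
have [C DC] := dual_density_bound c Q_gt0 cQ q Oh0 p0_gt0.
have C0 : 0 <= C by exact: le_trans (DC 0).
(* [C] bounds the density at 0; the rest is [|z| * expR |z|] with [|z| <= |q| * K * |t|], divided by
   [|t|], using [|t| < d] in the exponent. *)
exists (C * (`|q| * K * expR (`|q| * (K * d)))), d; split => // t td x.
have [Bx|Bx] := pselect (@punctured_ball R n x); last first.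
  rewrite dual_densityB dual_density_out// !mul0r normr0.
  by rewrite !mulr_ge0// expR_ge0.
have /andP[x0 x1] := Bx; have sx := sphere_normalize x0.
have py : 0 < gauge Omega h0 (normalize x) by apply: p0_gt0; rewrite sx.
have [_ XK] := Kd t (normalize x) td py.
have /andP[t0 tlt] := td.
rewrite dual_densityB -mulrA normrM; apply: ler_pM => //.
rewrite normrM normfV ler_pdivrMr//; apply: le_trans (norm_expR_sub1 _) _.
rewrite normrM; apply: (@le_trans _ _ (`|q| * (K * `|t|) * expR (`|q| * (K * d)))); last first.
  by rewrite le_eqVlt; apply/orP; left; apply/eqP; ring.
have XK' : `|q| * `|ln (gauge Omega h0 (normalize x)) - ln (gauge Omega (h t) (normalize x))| <=
    `|q| * (K * `|t|) by apply: ler_wpM2l.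
apply: (ler_pM _ _ XK'); rewrite ?mulr_ge0 ?expR_ge0//.
rewrite ler_expR; apply: le_trans XK' _.
by apply: ler_wpM2l => //; apply: ler_wpM2l => //; exact: ltW.
Qed.

Hypothesis pt_gt0 : forall t, `|t| < delta -> forall x, 0 < enorm x -> 0 < gauge Omega (h t) x.

Local Notation G := (fun x => D0 x * (q * (f \_ Omega) (gauss_map Oh0 x))).

Lemma measurable_variation : measurable_fun setT (G : V -> R).
Proof.
apply: measurable_funM; first exact: measurable_dual_density.
apply: measurable_funM => //.
exact: (measurableT_comp measurable_patch_Omega (measurable_gauss_map Oh0)).
Qed.

Lemma dual_density_quotient_integral_cvg (u : R^nat) : (forall k, u k != 0) -> u @ \oo --> 0 ->
  leb.-integrable setT (EFin \o G) /\
  (fun k => ((\int[leb]_x D (u k) x)%R - (\int[leb]_x D0 x)%R) / u k) @ \oo -->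
    (\int[leb]_x G x)%R.
Proof.
move=> u0 ucvg; have [B [d [d0 dd Bd]]] := dual_density_quotient_bound.
have [N _ uN] : \forall k \near \oo, `|u k| < d.
  move/cvgrPdist_lt: ucvg => /(_ _ d0); apply: filterS => k.
  by rewrite sub0r normrN.
(* Dropping [N] terms brings every parameter into the range where the gauges are controlled and the
   quotients are bounded. *)
pose v k := u (k + N)%N.
have v0 k : v k != 0 by exact: u0.
have vcvg : v @ \oo --> 0 by move: ucvg; rewrite -(cvg_shiftn N).
have vd k : 0 < `|v k| < d by rewrite normr_gt0 v0/=; apply: uN; rewrite /= leq_addl.
have vdelta k : `|v k| < delta by apply: lt_le_trans dd; case/andP: (vd k).
have mD0 : measurable_fun setT (D0 : V -> R) by exact: measurable_dual_density.
have mDv k : measurable_fun setT (D (v k) : V -> R).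
  by apply: measurable_dual_density => //; exact: Oh.
pose F k x := (D (v k) x - D0 x) / v k.
have mF k : measurable_fun setT (EFin \o F k : V -> \bar R).
  apply/measurable_EFinP.
  by apply: measurable_funM; [exact: measurable_funB|exact: measurable_cst].
have B0 : 0 <= B by exact: le_trans (Bd _ (vd 0%N) 0).
have iB : leb.-integrable setT (EFin \o (fun x => B * \1_(@punctured_ball R n) x)).
  apply: (@integrable_ball _ _ _ B).
  - by apply: measurable_funM => //; apply: measurable_indic; exact: measurable_punctured_ball.
  - by move=> x Bx; rewrite indicE memNset// mulr0.
  - move=> x; rewrite normrM (ger0_norm B0) ler_piMr// ger0_norm//.
have ptw : {ae leb, forall x : V, setT x -> (fun k => (EFin \o F k) x) @ \oo --> (EFin \o G) x}.
  have [Z [mZ Z0 sZ]] := negligible_gauge_sing Oh0.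
  exists Z; split => // x /= H.
  apply: sZ; apply: contrapT => xS; apply: H => _; apply: cvg_EFin.
    by apply: nearW.
  have -> : (f \_ Omega) (gauss_map Oh0 x) = f (gauss_map Oh0 x).
    by rewrite patchE mem_set//; exact: gauss_mapP.
  exact: dual_density_quotient_cvg.
have dom : {ae leb, forall (x : V) k, setT x ->
    (`|(EFin \o F k) x| <= (EFin \o (fun x => B * \1_(@punctured_ball R n) x)%R) x)%E}.
  apply: aeW => x k _ /=; rewrite lee_fin.
  have [Bx|Bx] := pselect (@punctured_ball R n x).
    by rewrite indicE mem_set// mulr1; exact: Bd.
  by rewrite /F !dual_density_out// subrr mul0r normr0 mulr_ge0.
have mG : measurable_fun setT (EFin \o G : V -> \bar R).
  by apply/measurable_EFinP; exact: measurable_variation.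
have [iG _ FG] := dominated_convergence measurableT mF mG ptw iB dom.
split => //.
have iD0 := integrable_dual_density c Q_gt0 cQ q Oh0 p0_gt0.
have iDv k := integrable_dual_density c Q_gt0 cQ q (Oh (vdelta k)) (pt_gt0 (vdelta k)).
have FE k : ((\int[leb]_x D (v k) x)%R - (\int[leb]_x D0 x)%R) / v k = fine (\int[leb]_x (F k x)%:E)%E.
  rewrite -[RHS]/(\int[leb]_x F k x)%R /F RintegralZr// ?RintegralB//.
  exact: (integrableB measurableT (iDv k) iD0).
rewrite -(cvg_shiftn N) (_ : (fun _ => _) = (fun k => fine (\int[leb]_x (F k x)%:E)%E)).
  apply: fine_cvg; rewrite fineK//; exact: integrable_fin_num.
by apply/funext => k; rewrite -FE.
Qed.

End Variation.

Unset Implicit Arguments.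
Set Strict Implicit.

Theorem theorem4p2 (R : realType) (n : nat)
  (Omega : set 'rV[R]_n) (h0 f : 'rV[R]_n -> R)
  (h o : R -> 'rV[R]_n -> R) (delta : R)
  (Q : set 'rV[R]_n) (q j : R)
  (mu : {measure set (borelRn R n) -> \bar R}) :
  (* Omega: closed subset of S^{n-1}, not contained in any closed hemisphere *)
  closed Omega -> Omega `<=` @sphere R n ->
  ~ (exists2 w, @sphere R n w & forall v, Omega v -> 0 <= dot v w) ->
  (* h0 : Omega -> (0,oo) and f : Omega -> R continuous *)
  {within Omega, continuous h0} -> (forall v, Omega v -> 0 < h0 v) ->
  {within Omega, continuous f} ->
  (* logarithmic family of Wulff shapes generated by (h0, f) *)
  0 < delta ->
  (forall v, Omega v -> h 0 v = h0 v) ->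
  (forall t, -delta < t < delta ->
     [/\ {within Omega, continuous (h t)}, (forall v, Omega v -> 0 < h t v),
         {within Omega, continuous (o t)} &
         forall v, Omega v -> ln (h t v) = ln (h0 v) + t * f v + o t v]) ->
  (forall e : R, 0 < e -> exists2 d : R, 0 < d &
     forall t, 0 < `|t| < d -> `|t| < delta -> forall v, Omega v -> `|o t v / t| < e) ->
  (* Q in S_o^n *)
  compact Q ->
  (forall x, Q x -> forall l : R, 0 <= l <= 1 -> Q (l *: x)) ->
  (forall u, @sphere R n u -> 0 < radial Q u) ->
  {within @sphere R n, continuous (radial Q)} ->
  j != n%:R -> q != 0 ->
  (* mu is the Borel measure C~_{q,j}([h_0],Q,.) (concentrated on S^{n-1}) *)
  (forall eta, measurable eta ->
     mu eta = Ctilde q j (wulff Omega h0) Q (eta `&` @sphere R n)) ->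
  (fun t => (Wtilde q j (wulff Omega (h t)) Q - Wtilde q j (wulff Omega h0) Q) / t)
    @ 0^' --> q * fine (\int[mu]_(v in Omega) (f v)%:E)%E.
Proof.
move=> clO OS hemi ch0 h0_gt0 cf delta0 h00 hfam osmall cQ Qstar Q0 ccQ jn q0 muE.
(* In dimension 0 the sphere is empty and [n%:R^-1] is 0, so both sides vanish. *)
have [n0|n0] := posnP n.
  subst n.
  have O0 : Omega = set0.
    apply/seteqP; split => // v /OS; rewrite /sphere /= /enorm /dot big_ord0 sqrtr0.
    by move/eqP; rewrite eq_sym oner_eq0.
  rewrite O0 integral_set0 mulr0 (_ : (fun _ => _) = cst 0); first exact: cvg_cst.
  by apply/funext => t; rewrite /Wtilde invr0 !mul0r subrr mul0r.
(* An empty [Omega] would lie in every hemisphere, and in positive dimension there is one. *)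
have O0 : Omega !=set0.
  apply/set0P/eqP => O0; apply: hemi; exists (delta_mx 0 (Ordinal n0)).
    by rewrite /sphere /= /enorm dot_delta mxE !eqxx sqrtr1.
  by move=> v; rewrite O0.
have cO : compact Omega by exact: subclosed_compact clO (@compact_sphere R n) OS.
have Oh0 : gauge_dom Omega h0 by split.
have tin t : `|t| < delta -> -delta < t < delta by rewrite ltr_norml.
have Oh t : `|t| < delta -> gauge_dom Omega (h t).
  by move=> /tin/hfam[cht ht0 _ _]; split.
have hE t : `|t| < delta -> forall v, Omega v -> h t v = h0 v * expR (t * f v + o t v).
  move=> /tin/hfam[_ ht0 _ lnE] v Ov.
  rewrite -[LHS]lnK ?posrE ?ht0// lnE// -addrA expRD lnK// posrE; exact: h0_gt0.
have p0_gt0 := gauge_gt0 Oh0 hemi.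
have pt_gt0 t (td : `|t| < delta) := gauge_gt0 (Oh t td) hemi.
set c := n%:R - q - j.
have WE t : `|t| < delta -> Wtilde q j (wulff Omega (h t)) Q =
    (\int[@lebRn R n]_x dual_density Q c q Omega (h t) x)%R.
  by move=> td; apply: Wtilde_wulff => //; [exact: Oh|exact: pt_gt0].
have W0 : Wtilde q j (wulff Omega h0) Q =
    (\int[@lebRn R n]_x dual_density Q c q Omega h0 x)%R by exact: Wtilde_wulff.
have muI A : measurable A -> mu A = (\int[@lebRn R n]_x
    (dual_density Q c q Omega h0 x * \1_A (gauss_map Oh0 x))%:E)%E.
  by move=> mA; rewrite muE// (Ctilde_wulff q j Oh0).
have mf := measurable_patch_Omega Oh0 cf.
have Omega_int : (\int[mu]_(v in Omega) (f v)%:E = \int[@lebRn R n]_x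
    (dual_density Q c q Omega h0 x * (f \_ Omega) (gauss_map Oh0 x))%:E)%E.
  rewrite -(integral_weighted_pushforward _ _ (measurable_gauss_map Oh0) muI mf).
  - by rewrite [LHS]integral_mkcond; apply: eq_integral => v _; rewrite !patchE; case: ifP.
  - exact: measurable_dual_density.
  - exact: dual_density_ge0.
(* Dominated convergence is sequential, so the punctured limit is tested along sequences of nonzero
   terms tending to 0. *)
apply/cvgr_dnbhsP => u [u0 ucvg].
have [iG Gcvg] := dual_density_quotient_integral_cvg c q delta0 Oh0 Oh hE cf
  osmall p0_gt0 Q0 ccQ pt_gt0 u0 ucvg.
have GE : (\int[@lebRn R n]_x (dual_density Q c q Omega h0 x *
    (q * (f \_ Omega) (gauss_map Oh0 x))))%R = q * fine (\int[mu]_(v in Omega) (f v)%:E)%E.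
  rewrite Omega_int -[fine _]/(\int[@lebRn R n]_x (dual_density Q c q Omega h0 x *
    (f \_ Omega) (gauss_map Oh0 x)))%R.
  (* Integrability is known for the integrand that contains [q], so [q^-1] is moved inside that
     integral. *)
  rewrite -[LHS](mulVKf q0); congr (_ * _); rewrite -RintegralZl//.
  by apply: eq_Rintegral => x _; rewrite mulrCA mulKf.
rewrite -GE; apply: cvg_trans Gcvg; apply: near_eq_cvg.
(* The density formula for [Wtilde] holds for [|t| < delta], hence for all but finitely many terms
   of the sequence. *)
move/cvgrPdist_lt: ucvg => /(_ _ delta0); apply: filterS => k.
by rewrite sub0r normrN => kd; rewrite WE ?W0.
Qed.
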